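(* Let $a<b<c$ be real numbers and let $F$ and $G$ be two (probability) distribution functions supported on $[a,b]$. The following two characterizations hold. (i) For $n=2$: we have $\int_a^b u(x)\,dG(x)\ge \int_a^b u(x)\,dF(x)$ for every $u\in U_{2,[a,c]}\cap LP_{2,[a,c]}=U_{2,[a,c]}\cap AP_{2,[a,c]}$ if and only if $$LPM_{2,t}(F)\ge LPM_{2,t}(G)\quad\text{for all } t\in[a,b]\cup\{c\}.$$ (ii) For $n=3$: we have $\int_a^b u(x)\,dG(x)\ge \int_a^b u(x)\,dF(x)$ for every $u\in U_{3,[a,c]}\cap LP_{3,[a,c]}=U_{3,[a,c]}\cap AP_{3,[a,c]}$ if and only if both of the following conditions hold: (a) $LPM_{3,t}(F)\ge LPM_{3,t}(G)$ for all $t\in[a,b]\cup\{c\}$; (b) if $$LPM_{1,b}(F)-LPM_{1,b}(G)>0$$ and $$-2(c-b)\left(LPM_{1,b}(F)-LPM_{1,b}(G)\right)<LPM_{2,b}(F)-LPM_{2,b}(G)<0,$$ then $$4\left(LPM_{1,b}(F)-LPM_{1,b}(G)\right)\left(LPM_{3,b}(F)-LPM_{3,b}(G)\right)\ge 3\left(LPM_{2,b}(F)-LPM_{2,b}(G)\right)^2.$$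
   Context: $C^{m}([a,c])$ is the set of $m$ times continuously differentiable functions $u:[a,c]\to\mathbb{R}$ (one-sided derivatives at the endpoints); $u^{(k)}$ is the $k$-th derivative. ''Decreasing'' is in the weak sense. Integrals $\int_a^b \cdot\, dF$ are over the closed interval $[a,b]$, including possible atoms at $a$ and $b$. For a positive integer $n$ and $a<c$: $$U_{n,[a,c]} := \{u \in C^{n+1}([a,c]) : (-1)^{k}u^{(k)}(x) \le 0 \ \ \forall x\in[a,c],\ \forall k=1,\dots,n+1\},$$ $$LP_{n,[a,c]} := \{u:[a,c]\to\mathbb{R} : (u(c)-u(x))^{1/n} \text{ is convex and decreasing (as a function of } x) \text{ on } [a,c]\},$$ $$AP_{n,[a,c]} := \{u\in C^2([a,c]) : u^{(1)}(x)\ge 0,\ u^{(2)}(x)\le 0,\ (n-1)u^{(1)}(x)+u^{(2)}(x)(c-x)\le 0\ \ \forall x\in[a,c]\}.$$ The $n$-th lower partial moment of a distribution function $F$ at $t\in\mathbb{R}$ is $LPM_{n,t}(F)=\int_{-\infty}^{\infty}\max\{t-x,0\}^n\,dF(x)$. *)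

(* Defs.v *)
From HB Require Import structures.
From mathcomp Require Import all_boot all_order all_algebra.
From mathcomp Require Import all_classical all_reals all_analysis.
Set Implicit Arguments.
Unset Strict Implicit.
Unset Printing Implicit Defensive.
Import Order.TTheory GRing.Theory Num.Theory.
Import numFieldNormedType.Exports.
Local Open Scope classical_set_scope.
Local Open Scope ring_scope.

(* A function u : [a, c] -> R is represented by a total function u : R -> R:
   every notion below depends only on the values of u on [a, c]. *)

Definition diffquot (R : realType) (u : R -> R) (x y : R) : R :=
  (u y - u x) / (y - x).

(* The limit is taken within [a, c], hence it is the one-sided derivative when
   x is an endpoint. *)
Definition derivable_on (R : realType) (a c : R) (u : R -> R) (x : R) : Prop :=
  cvg (diffquot u x y @[y --> within `[a, c] x^']).

Definition deriv_on (R : realType) (a c : R) (u : R -> R) (x : R) : R :=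
  lim (diffquot u x y @[y --> within `[a, c] x^']).

Definition derivn_on (R : realType) (a c : R) (k : nat) (u : R -> R) : R -> R :=
  iter k (deriv_on a c) u.

Definition contdiff_on (R : realType) (a c : R) (m : nat) : set (R -> R) :=
  [set u | (forall k, (k < m)%N -> forall x, x \in `[a, c] ->
              derivable_on a c (derivn_on a c k u) x) /\
           {within `[a, c], continuous (derivn_on a c m u)}].

Definition Uset (R : realType) (n : nat) (a c : R) : set (R -> R) :=
  [set u | contdiff_on a c n.+1 u /\
           forall x, x \in `[a, c] -> forall k, (1 <= k <= n.+1)%N ->
             (-1) ^+ k * derivn_on a c k u x <= 0].

(* u x <= u c makes the real n-th root meaningful; it is stated because powR
   takes the junk value 1 (for a nonzero exponent 1/n on negative reals). *)
Definition LPset (R : realType) (n : nat) (a c : R) : set (R -> R) :=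
  [set u | let f := fun x => (u c - u x) `^ n%:R^-1 in
           [/\ forall x, x \in `[a, c] -> u x <= u c,
               convex_function (`[a, c] : set R^o) f &
               {in `[a, c] &, {homo f : x y /~ x <= y}}]].

Definition APset (R : realType) (n : nat) (a c : R) : set (R -> R) :=
  [set u | contdiff_on a c 2 u /\
           forall x, x \in `[a, c] ->
             [/\ 0 <= derivn_on a c 1 u x,
                 derivn_on a c 2 u x <= 0 &
                 (n%:R - 1) * derivn_on a c 1 u x
                   + derivn_on a c 2 u x * (c - x) <= 0]].

(* The type cumulativeBounded 0 1 is that of probability distribution functions:
   nondecreasing, right-continuous, with limits 0 at -oo and 1 at +oo. *)
Definition supported_on (R : realType) (a b : R)
    (F : cumulativeBounded (0 : R) (1 : R)) : Prop :=
  lebesgue_stieltjes_measure F (~` `[a, b]) = 0%E.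

Definition integral_dF (R : realType) (a b : R)
    (F : cumulativeBounded (0 : R) (1 : R)) (u : R -> R) : R :=
  \int[lebesgue_stieltjes_measure F]_(x in `[a, b]) u x.

Definition LPM (R : realType) (n : nat) (t : R)
    (F : cumulativeBounded (0 : R) (1 : R)) : R :=
  \int[lebesgue_stieltjes_measure F]_x (Num.max (t - x) 0 ^+ n).

(* Main.v *)
(* Let K_n be the set of u in U_n with u^(k)(c) = 0 for 0 < k < n.  With
   w_0 = u(c) - u and w_k = (-1)^(k+1) u^(k), membership in U_n says that
   w_k >= 0 and w_k' = - w_(k+1); approximating w_n by a step function and
   integrating n times shows that, for u in K_n, w_0 is a uniform limit of
   nonnegative combinations of the kernels (t - x)_+^n with t <= c.
   - Each kernel is the n-th power of a convex function, so by Minkowski's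
     inequality K_n is contained in LP_n; conversely, convexity of w_0^(1/n)
     gives w_0(x) = O((c - x)^n), which forces the derivatives at c to vanish.
   - The inequality m w_j <= (c - x) w_(j+1) propagates by integration, whence
     K_n is contained in AP_n; for n <= 3 the condition defining AP_n, read near
     c, gives the converse.
   - Hence dominance over K_n means LPM_n,t(F) >= LPM_n,t(G) for t in [a, c];
     necessity uses second differences of (t - x)_+^(n+2) as smooth kernels.
   - As F and G have the same mass, the difference of the LPM_n,t is for t >= b
     a polynomial in t - b of degree n - 1: affine for n = 2, quadratic for
     n = 3, and (b) is the discriminant condition when its vertex lies in
     [b, c]. *)
Require Import Defs.
From HB Require Import structures.
From mathcomp Require Import all_boot all_order all_algebra.
From mathcomp Require Import all_classical all_reals all_analysis.
From mathcomp Require Import measurable_realfun.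
From mathcomp Require Import ring lra.
Set Implicit Arguments.
Unset Strict Implicit.
Unset Printing Implicit Defensive.
Import Order.TTheory GRing.Theory Num.Theory.
Import numFieldNormedType.Exports.
Local Open Scope classical_set_scope.
Local Open Scope ring_scope.

(** * Derivatives on a segment *)

Lemma diffquot_cvgP (R : realType) (a c : R) (u : R -> R) (x l : R) :
  diffquot u x y @[y --> within `[a, c] x^'] --> l <->
  forall e, 0 < e -> exists2 d, 0 < d & forall y, y \in `[a, c] -> y != x ->
    `|x - y| < d -> `|l - diffquot u x y| <= e.
Proof.
split=> [/cvgrPdist_le h e e0|h].
  have /nbhs_normP[d /= d0 dP] := h e e0.
  by exists d => // y yac yx xyd; apply: dP.
apply/cvgrPdist_le => e e0; have [d d0 dP] := h e e0.
by apply/nbhs_normP; exists d => //= y xyd yx yac; exact: dP.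
Qed.

(** Properness makes limits along this filter unique, so that [deriv_on] can be computed by
    exhibiting a limit. *)
Lemma within_dnbhs_proper (R : realType) (a c x : R) : a < c ->
  x \in `[a, c] -> ProperFilter (within `[a, c] x^').
Proof.
move=> ac; rewrite in_itv/= => /andP[ax xc].
apply: Build_ProperFilter => /= /nbhs_normP[d /= d0 dP].
have dac : 0 < Num.min d (c - a) / 2.
  by rewrite divr_gt0// lt_min d0 subr_gt0.
have dd : Num.min d (c - a) / 2 < d.
  by rewrite ltr_pdivrMr// mulr_natr mulr2n ltr_pwDl// ge_min lexx.
have dca : Num.min d (c - a) / 2 <= (c - a) / 2.
  by rewrite ler_pM2r ?invr_gt0// ge_min lexx orbT.
move: (Num.min d (c - a) / 2) dac dd dca => r r0 rd rca.
(* From the left half of [a, c] a step of length r <= (c - a) / 2 to the right stays inside; from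
   the right half, a step to the left does. *)
have [xm|xm] := leP x ((a + c) / 2).
- apply: (dP (x + r)) => /=; last first.
  + by rewrite in_itv/=; apply/andP; split; lra.
  + by apply/eqP; lra.
  + by rewrite opprD addrA subrr sub0r normrN gtr0_norm.
- apply: (dP (x - r)) => /=; last first.
  + by rewrite in_itv/=; apply/andP; split; lra.
  + by apply/eqP; lra.
  + by rewrite opprB addrC subrK gtr0_norm.
Qed.

Lemma deriv_on_eq (R : realType) (a c : R) (u : R -> R) (x l : R) : a < c ->
  x \in `[a, c] -> diffquot u x y @[y --> within `[a, c] x^'] --> l ->
  derivable_on a c u x /\ deriv_on a c u x = l.
Proof.
move=> ac xac ul; have := within_dnbhs_proper ac xac; split.
  by apply/cvg_ex; exists l.
exact/cvg_lim.
Qed.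

Lemma deriv_on_congr (R : realType) (a c : R) (u v : R -> R) (x : R) :
  x \in `[a, c] -> {in `[a, c], u =1 v} ->
  derivable_on a c u x = derivable_on a c v x /\
  deriv_on a c u x = deriv_on a c v x.
Proof.
move=> xac uv.
suff E : diffquot u x y @[y --> within `[a, c] x^'] =
    diffquot v x y @[y --> within `[a, c] x^'].
  by rewrite /derivable_on /deriv_on E.
apply/seteqP; split => P /= [d d0 dP]; exists d => // y /= xy yx yac;
  by move: (dP y xy yx yac); rewrite /= /diffquot !uv.
Qed.

Lemma is_derive_diffquot (R : realType) (a c : R) (u : R -> R) (x l : R) :
  is_derive x 1 u l -> diffquot u x y @[y --> within `[a, c] x^'] --> l.
Proof.
move=> [du ul]; apply/diffquot_cvgP => e e0.
have : h^-1 *: ((u \o shift x) (h *: 1) - u x) @[h --> 0^'] --> l.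
  by rewrite -ul; exact: du.
move/cvgrPdist_le => /(_ e e0) /nbhs_normP[d /= d0 dP].
exists d => // y yac yx xyd.
have := dP (y - x); rewrite /= sub0r normrN distrC => /(_ xyd).
rewrite subr_eq0 => /(_ yx).
by rewrite /diffquot /shift/= [(y - x) *: 1]mulr1 subrK mulrC.
Qed.

Lemma diffquot_is_derive (R : realType) (a c : R) (u : R -> R) (x l : R) :
  x \in `]a, c[ -> diffquot u x y @[y --> within `[a, c] x^'] --> l ->
  is_derive x 1 u l.
Proof.
rewrite in_itv/= => /andP[ax xc] /diffquot_cvgP h.
suff H : h^-1 *: ((u \o shift x) (h *: 1) - u x) @[h --> 0^'] --> l.
  by split; [apply/cvg_ex; exists l|exact/cvg_lim].
apply/cvgrPdist_le => e /h[d d0 dP].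
(* The radius is cut down so that y + x stays in [a, c], the only place where difference quotients
   are controlled. *)
apply/nbhs_normP; exists (Num.min d (Num.min (x - a) (c - x))) => /=.
  by rewrite !lt_min d0 !subr_gt0 ax.
move=> y /=; rewrite sub0r normrN !lt_min => /and3P[yd].
rewrite !ltr_norml => /andP[y1 y2] /andP[y3 y4] y0.
have := dP (y + x); rewrite /diffquot addrK /shift/= [y *: 1]mulr1.
rewrite opprD addrCA subrr addr0 normrN mulrC; apply => //.
  by rewrite in_itv/=; apply/andP; split; lra.
by rewrite -subr_eq0 addrK.
Qed.

Lemma derivable_on_continuous (R : realType) (a c : R) (u : R -> R) :
  (forall x, x \in `[a, c] -> derivable_on a c u x) ->
  {within `[a, c], continuous u}.
Proof.
move=> du; apply/subspace_continuousP => x /= xac.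
apply/cvgrPdist_le => e e0.
have /diffquot_cvgP /(_ _ ltr01)[d d0 dP] := du x xac.
set l := lim _ in dP.
have l1 : 0 < `|l| + 1 by rewrite ltr_wpDl.
(* Within distance d the difference quotient is bounded by |l| + 1, hence |u x - u y| <= (|l| + 1)
   |x - y|. *)
apply/nbhs_normP; exists (Num.min d (e / (`|l| + 1))) => /=.
  by rewrite lt_min d0 divr_gt0.
move=> y /=; rewrite lt_min ltr_pdivlMr// => /andP[xyd xye] yac.
have [->|yx] := eqVneq y x; first by rewrite subrr normr0 ltW.
have {}dP := dP y yac yx xyd.
have yx0 : y - x != 0 by rewrite subr_eq0.
have -> : u x - u y = diffquot u x y * (x - y).
  by rewrite /diffquot -opprB -[x - y]opprB mulrN divfK.
rewrite normrM mulrC (le_trans _ (ltW xye))// ler_wpM2l//.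
rewrite -[diffquot _ _ _](subrK l) addrC (le_trans (ler_normD _ _))// lerD2l.
by rewrite distrC.
Qed.

(* Derivatives of functions on [a, c] are only handled through this relation:
   one-sided derivatives at the endpoints enter only as continuity. *)
Definition has_deriv (R : realType) (a c : R) (f g : R -> R) : Prop :=
  {within `[a, c], continuous f} /\
  forall x, x \in `]a, c[ -> is_derive x 1 f (g x).

Lemma deriv_on_has_deriv (R : realType) (a c : R) (u : R -> R) :
  (forall x, x \in `[a, c] -> derivable_on a c u x) ->
  has_deriv a c u (deriv_on a c u).
Proof.
move=> du; split; first exact: derivable_on_continuous.
move=> x xac; apply: (@diffquot_is_derive _ a c) => //.
by apply: du; exact: subset_itv_oo_cc xac.
Qed.

Lemma is_derive_has_deriv (R : realType) (a c : R) (f g : R -> R) :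
  (forall x : R, is_derive x 1 f (g x)) -> has_deriv a c f g.
Proof.
move=> fg; split=> //; apply: derivable_within_continuous => x _.
by have [] := fg x.
Qed.

Section has_deriv_theory.
Context (R : realType) (a c : R).
Implicit Types f g : R -> R.

Lemma has_deriv_eq f g g' : {in `]a, c[, g =1 g'} -> has_deriv a c f g ->
  has_deriv a c f g'.
Proof. by move=> gg' [cf df]; split=> // x xac; rewrite -gg'//; exact: df. Qed.

Lemma has_derivD f f' g g' : has_deriv a c f f' -> has_deriv a c g g' ->
  has_deriv a c (f \+ g) (f' \+ g').
Proof.
move=> [cf df] [cg dg]; split.
  by apply: within_continuousD.
by move=> x xac; apply: is_deriveD; [exact: df|exact: dg].
Qed.

Lemma has_derivN f f' : has_deriv a c f f' ->
  has_deriv a c (\- f) (\- f').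
Proof.
move=> [cf df]; split.
  by move=> x; apply: continuousN; exact: cf.
by move=> x xac; apply: is_deriveN; exact: df.
Qed.

Lemma has_derivB f f' g g' : has_deriv a c f f' -> has_deriv a c g g' ->
  has_deriv a c (f \- g) (f' \- g').
Proof. by move=> df dg; exact: has_derivD df (has_derivN dg). Qed.

Lemma has_derivM f f' g g' : has_deriv a c f f' -> has_deriv a c g g' ->
  has_deriv a c (f \* g) (fun x => f x * g' x + g x * f' x).
Proof.
move=> [cf df] [cg dg]; split.
  by move=> x; apply: continuousM; [exact: cf|exact: cg].
by move=> x xac; apply: is_deriveM; [exact: df|exact: dg].
Qed.

Lemma has_deriv_homo f f' : has_deriv a c f f' ->
  {in `]a, c[, forall x, 0 <= f' x} ->
  {in `[a, c] &, {homo f : x y / x <= y}}.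
Proof.
move=> [cf df] f'0; apply: ger0_derive1_le_cc => // x xac.
  by have [] := df x xac.
by have [_] := df x xac; rewrite derive1E => ->; exact: f'0.
Qed.

(** Integration from the right endpoint: f is nonincreasing, so it stays above f(c). Inequalities
    between derivatives are lifted to the functions in this way. *)
Lemma has_deriv_ge0 f f' : has_deriv a c f f' ->
  {in `]a, c[, forall x, f' x <= 0} -> 0 <= f c ->
  {in `[a, c], forall x, 0 <= f x}.
Proof.
move=> df f'0 fc x xac; apply: (le_trans fc).
rewrite -lerN2; apply: (has_deriv_homo (has_derivN df)) => //.
- by move=> y yac /=; rewrite oppr_ge0 f'0.
- by move: xac; rewrite !in_itv/= => /andP[ax xc]; rewrite (le_trans ax xc)/=.
- by move: xac; rewrite !in_itv/= => /andP[].
Qed.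

Lemma has_deriv_bound f f' (e : R) : has_deriv a c f f' -> 0 <= e ->
  {in `]a, c[, forall x, `|f' x| <= e} -> f c = 0 ->
  {in `[a, c], forall x, `|f x| <= e * (c - a)}.
Proof.
move=> df e0 f'e fc x xac.
(* The barrier e (c - y) has slope -e and vanishes at c like f; it is compared with f and with
   -f. *)
have dl : has_deriv a c (fun y : R => e * (c - y)) (fun=> - e).
  apply: is_derive_has_deriv => y; have -> : (fun y : R => e * (c - y)) =
    (e \*: (cst c - id)) by apply/funext.
  by apply: is_derive_eq; rewrite sub0r scalerN [_ *: _]mulr1.
have xbound : e * (c - x) <= e * (c - a).
  by rewrite ler_wpM2l// lerD2l lerN2; move: xac; rewrite in_itv/= => /andP[].
rewrite (le_trans _ xbound)// ler_norml.
have h1 := has_deriv_ge0 (has_derivB dl df).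
have h2 := has_deriv_ge0 (has_derivD dl df).
apply/andP; split.
- rewrite -subr_ge0 opprK addrC; apply: h2 => //=; last first.
    by rewrite subrr mulr0 fc addr0.
  move=> y /f'e; rewrite ler_norml => /andP[_]; lra.
- rewrite -subr_ge0; apply: h1 => //=; last first.
    by rewrite subrr mulr0 fc subr0.
  move=> y /f'e; rewrite ler_norml => /andP[+ _]; lra.
Qed.


Lemma has_derivZ f f' (k : R) : has_deriv a c f f' ->
  has_deriv a c (fun x => k * f x) (fun x => k * f' x).
Proof.
move=> df; have dk : has_deriv a c (cst k) (cst 0).
  exact: is_derive_has_deriv.
apply: has_deriv_eq (has_derivM dk df) => x _ /=.
by rewrite mulr0 addr0.
Qed.

Lemma has_deriv_MVT f f' (x y : R) : has_deriv a c f f' ->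
  x \in `[a, c] -> y \in `[a, c] -> x <= y ->
  exists2 z, z \in `[x, y] & f y - f x = f' z * (y - x).
Proof.
move=> [cf df] xac yac xy.
have sxy z : z \in `]x, y[ -> z \in `]a, c[.
  by move: xac yac; rewrite !in_itv/= => /andP[? ?] /andP[? ?] /andP[? ?]; lra.
have sub : `[x, y] `<=` `[a, c].
  by move=> z /=; move: xac yac; rewrite !in_itv/=; lra.
have cxy : {within `[x, y], continuous f} by exact: continuous_subspaceW cf.
exact: (MVT_segment xy (fun z zxy => df z (sxy z zxy)) cxy).
Qed.

Lemma has_deriv_powc (k : nat) :
  has_deriv a c (fun x => (c - x) ^+ k.+1)
                (fun x => - (k.+1%:R * (c - x) ^+ k)).
Proof.
apply: is_derive_has_deriv => x.
have -> : (fun y : R => (c - y) ^+ k.+1) = (cst c - id) ^+ k.+1.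
  by apply/funext => y; rewrite fctE.
apply: is_derive_eq; rewrite sub0r /= scalerN.
by rewrite [_ *: _]mulr1.
Qed.

Lemma invf_factS (k : nat) : k.+1%:R / k.+1`!%:R = (k`!%:R)^-1 :> R.
Proof.
by rewrite factS natrM invfM mulrA divff ?mul1r// pnatr_eq0.
Qed.

Lemma has_deriv_powc_fact (k : nat) :
  has_deriv a c (fun x => (c - x) ^+ k.+1 / k.+1`!%:R)
                (fun x => - ((c - x) ^+ k / k`!%:R)).
Proof.
have := has_derivZ (k.+1`!%:R)^-1 (has_deriv_powc k).
under eq_fun do rewrite mulrC.
apply: has_deriv_eq => x _.
by rewrite -(invf_factS k); ring.
Qed.

End has_deriv_theory.

(** * Alternating derivatives *)

(** The signs are normalized, and [w] is an arbitrary sequence rather than the derivatives of a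
    given u: it can then be shifted ([alternatingS]), which drives the inductions. *)
Definition alternating (R : realType) (a c : R) (n : nat)
    (w : nat -> R -> R) : Prop :=
  [/\ forall k, (k <= n)%N -> has_deriv a c (w k) (fun x => - w k.+1 x),
      {within `[a, c], continuous (w n.+1)} &
      forall k, (k <= n.+1)%N -> {in `[a, c], forall x, 0 <= w k x}].

(** The entry at 0 is u(c) - u rather than -u: it has the same derivative, is nonnegative and
    vanishes at c. *)
Definition alternating_derivs (R : realType) (a c : R) (u : R -> R) (k : nat) :
    R -> R :=
  if k is 0 then fun x => u c - u x
  else fun x => - ((-1) ^+ k * derivn_on a c k u x).

(** The class K_n, through which [LPset] and [APset] are compared and on which dominance is
    studied. *)
Definition vanishing_Uset (R : realType) (n : nat) (a c : R) : set (R -> R) :=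
  [set u | Uset n a c u /\
           forall k, (0 < k < n)%N -> derivn_on a c k u c = 0].

Section alternating_theory.
Context (R : realType) (a c : R) (ac : a < c).
Implicit Types (u : R -> R) (w : nat -> R -> R).

Let aac : a \in `[a, c]. Proof. by rewrite in_itv/= lexx ltW. Qed.
Let cac : c \in `[a, c]. Proof. by rewrite in_itv/= lexx ltW. Qed.
Let oocc x : x \in `]a, c[ -> x \in `[a, c].
Proof. exact: subset_itv_oo_cc. Qed.
Let lec x : x \in `[a, c] -> x <= c. Proof. by rewrite in_itv/= => /andP[]. Qed.

Lemma Uset_has_deriv n u : Uset n a c u -> forall k, (k <= n)%N ->
  has_deriv a c (derivn_on a c k u) (derivn_on a c k.+1 u).
Proof.
move=> [[du _] _] k kn; apply: deriv_on_has_deriv => x xac.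
exact: du.
Qed.

Lemma Uset_nondecreasing n u : Uset n a c u ->
  {in `[a, c] &, {homo u : x y / x <= y}}.
Proof.
move=> Uu; have := Uset_has_deriv Uu (leq0n n).
move=> /has_deriv_homo; apply => x /oocc xac.
have [_ /(_ x xac 1%N)] := Uu.
by rewrite ltnS leq0n expr1 mulN1r oppr_le0 /=; exact.
Qed.

Lemma Uset_alternating n u : Uset n a c u ->
  alternating a c n (alternating_derivs a c u).
Proof.
move=> Uu; split.
- case=> [|k] kn; have du := Uset_has_deriv Uu kn.
    apply: has_deriv_eq (has_derivB (is_derive_has_deriv a c
      (fun x => is_derive_cst (u c) x 1)) du) => x _ /=.
    by rewrite expr1 mulN1r opprK sub0r.
  apply: has_deriv_eq (has_derivN (has_derivZ ((-1) ^+ k.+1) du)) => x _ /=.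
  by rewrite opprK [in RHS]exprS mulN1r mulNr.
- case: Uu => -[_ cu] _.
  by move=> x; apply: cvgN; apply: cvgM; [exact: cvg_cst|exact: cu].
- case=> [_|k kn] x xac /=.
    by rewrite subr_ge0 (Uset_nondecreasing Uu)// lec.
  by rewrite oppr_ge0; case: Uu => _; apply.
Qed.

Lemma alternatingS n w : alternating a c n.+1 w ->
  alternating a c n (fun k => w k.+1).
Proof. by case=> dw cw w0; split=> // k kn; [exact: dw|exact: w0]. Qed.

Lemma alternating_lower_bound k n w (m : R) : alternating a c n w ->
  (k <= n)%N -> 0 <= m -> {in `[a, c], forall x, m <= w k x} ->
  {in `[a, c], forall x, m * ((c - x) ^+ k / k`!%:R) <= w 0%N x}.
Proof.
elim: k n w => [|k IH] n w Aw kn m0 mw x xac.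
  by rewrite expr0 fact0 invr1 !mulr1 mw.
case: n Aw kn => // n Aw kn.
have {}IH := IH n _ (alternatingS Aw) kn m0 mw.
case: Aw => dw _ w0; rewrite -subr_ge0.
apply: (has_deriv_ge0 (has_derivB (dw 0%N (leq0n _))
  (has_derivZ m (has_deriv_powc_fact a c k)))) => //=.
- by move=> y /oocc/IH; lra.
- by rewrite subrr expr0n /= mul0r mulr0 subr0 w0.
Qed.

(** For w_0 = (c - x)^m this is an equality. In the step to m + 1, the function w_1 (c - x) - (m +
    1) w_0 vanishes at c and has derivative m w_1 - w_2 (c - x), nonpositive by induction on the
    shifted sequence. *)
Lemma alternating_homogeneity m n w : alternating a c n w -> (m <= n)%N ->
  (forall k, (k < m)%N -> w k c = 0) ->
  {in `[a, c], forall x, m%:R * w 0%N x <= w 1%N x * (c - x)}.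
Proof.
elim: m n w => [|m IH] n w Aw mn wc x xac.
  by rewrite mul0r mulr_ge0 ?subr_ge0 ?lec//; case: Aw => _ _; apply.
case: n Aw mn => // n Aw mn.
have {}IH := IH n _ (alternatingS Aw) mn (fun k km => wc k.+1 km).
case: Aw => dw _ w0; rewrite -subr_ge0.
have dc := has_deriv_powc a c 0.
apply: (has_deriv_ge0 (has_derivB (has_derivM (dw 1%N isT) dc)
  (has_derivZ m.+1%:R (dw 0%N (leq0n _))))) => //=.
- by move=> y /oocc/IH; rewrite expr1 expr0 -[m.+1]addn1 natrD; lra.
- by rewrite (wc 0%N isT) subrr expr1 !mulr0 subr0.
Qed.

End alternating_theory.

(** * Vanishing of the derivatives at c *)

Lemma root_exprK (R : realType) (n : nat) (x : R) : (0 < n)%N -> 0 <= x ->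
  (x `^ n%:R^-1) ^+ n = x.
Proof.
move=> n0 x0; rewrite -powR_mulrn ?powR_ge0// -powRrM mulVf ?powRr1//.
by rewrite pnatr_eq0 -lt0n.
Qed.

Lemma le0_linear_bound (R : realType) (C V h : R) : 0 < h -> 0 <= V ->
  (forall s, 0 < s -> s <= h -> C <= V * s) -> C <= 0.
Proof.
move=> h0 V0 CV; rewrite leNgt; apply/negP => C0.
have D0 : 0 < C + V * h by rewrite ltr_pwDl// mulr_ge0// ltW.
(* This s lies in ]0, h], and V s = C V h / (C + V h) < C contradicts the hypothesis. *)
have := CV (h * C / (C + V * h)); rewrite !divr_gt0 ?mulr_gt0//.
rewrite ler_pdivrMr// ler_wpM2l ?(ltW h0) ?lerDl ?mulr_ge0 ?(ltW h0)//.
move=> /(_ isT isT); rewrite mulrA ler_pdivlMr// => h1.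
have : 0 < C * C by rewrite mulr_gt0.
lra.
Qed.

Section vanishing.
Context (R : realType) (a c : R) (ac : a < c).
Implicit Types (u : R -> R) (w : nat -> R -> R).

Let aac : a \in `[a, c]. Proof. by rewrite in_itv/= lexx ltW. Qed.
Let cac : c \in `[a, c]. Proof. by rewrite in_itv/= lexx ltW. Qed.
Let lec x : x \in `[a, c] -> x <= c. Proof. by rewrite in_itv/= => /andP[]. Qed.

Lemma alternating_nonincreasing n w k : alternating a c n w -> (k <= n)%N ->
  {in `[a, c] &, {homo w k : x y /~ x <= y}}.
Proof.
case=> dw _ w0 kn x y xac yac yx; rewrite -lerN2.
apply: (has_deriv_homo (has_derivN (dw k kn))) => // z zac /=.
by rewrite opprK w0//; exact: subset_itv_oo_cc zac.
Qed.

Lemma alternating_derivs_vanish n u : vanishing_Uset n a c u ->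
  forall k, (k < n)%N -> alternating_derivs a c u k c = 0.
Proof.
move=> [_ uc] [|k] kn; rewrite /alternating_derivs ?subrr//.
by rewrite uc// mulr0 oppr0.
Qed.

Lemma vanishing_UsetP n u : Uset n a c u ->
  (forall k, (0 < k < n)%N -> alternating_derivs a c u k c <= 0) ->
  vanishing_Uset n a c u.
Proof.
move=> Uu uc; split=> // -[//|k] kn.
have [_ _ /(_ k.+1)] := Uset_alternating ac Uu.
move=> /(_ (leq_trans (ltnW (proj2 (andP kn))) (leqnSn n)) c cac).
have := uc k.+1 kn; rewrite /alternating_derivs => h1 h2.
have /eqP : - ((-1) ^+ k.+1 * derivn_on a c k.+1 u c) = 0.
  by apply: le_anti; rewrite h1 h2.
by rewrite oppr_eq0 mulf_eq0 signr_eq0/= => /eqP.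
Qed.

(** The convex root vanishes at c, so at t a + (1 - t) c it is at most t times its value at a; then
    take n-th powers. *)
Lemma LPset_bound n u (t : R) : (0 < n)%N -> LPset n a c u -> 0 <= t <= 1 ->
  u c - u (t * a + (1 - t) * c) <= t ^+ n * (u c - u a).
Proof.
move=> n0 [uc + _] /andP[t0 t1] => /(_ (Itv01 t0 t1) a c).
rewrite !inE => /(_ aac cac).
(* The root of 0 is 0 only because the exponent 1/n is nonzero: 0 to the power 0 is 1. *)
rewrite !convRE /= subrr powR0 ?invr_eq0 ?pnatr_eq0 -?lt0n// mulr0 addr0 => h.
have xac : t * a + (1 - t) * c \in `[a, c].
  by rewrite in_itv/=; apply/andP; split; move: ac; nra.
rewrite -(root_exprK n0 (_ : 0 <= u c - u a)) ?subr_ge0 ?uc//.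
rewrite -[leLHS](root_exprK n0) ?subr_ge0 ?uc// -exprMn.
by rewrite lerXn2r// nnegrE ?mulr_ge0 ?powR_ge0.
Qed.

(** With m = w_k(c), w_0 is at least m (c - x)^k / k!, whereas convexity makes it of order (c - x)^n
    near c. As k < n, this forces m = 0. *)
Lemma LPset_vanishing n u : (0 < n)%N -> Uset n a c u -> LPset n a c u ->
  vanishing_Uset n a c u.
Proof.
move=> n0 Uu Lu; apply: vanishing_UsetP => // k /andP[k0 kn].
have Au := Uset_alternating ac Uu; have [_ _ w0] := Au.
set w := alternating_derivs a c u in Au w0 *.
set m := w k c; have m0 : 0 <= m by apply: w0; rewrite ?(leq_trans (ltnW kn)).
have mw : {in `[a, c], forall x, m <= w k x}.
  move=> x xac; apply: (alternating_nonincreasing Au) => //.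
    exact: ltnW.
  exact: lec.
have lb := alternating_lower_bound ac Au (ltnW kn) m0 mw.
have v0 : 0 <= u c - u a by exact: (w0 0%N).
have p0 : 0 < (c - a) ^+ k / k`!%:R.
  by rewrite divr_gt0 ?exprn_gt0 ?subr_gt0// ltr0n fact_gt0.
rewrite -(pmulr_lle0 _ p0) mulrC.
apply: (@le0_linear_bound _ _ (u c - u a) 1) => // t t0 t1.
have xac : t * a + (1 - t) * c \in `[a, c].
  by rewrite in_itv/=; apply/andP; split; move: ac; nra.
have t01 : 0 <= t <= 1 by rewrite (ltW t0).
have := le_trans (lb _ xac) (LPset_bound n0 Lu t01).
have -> : c - (t * a + (1 - t) * c) = t * (c - a) by ring.
have tk0 : 0 < t ^+ k by rewrite exprn_gt0.
(* Here t^n is written as t^k t t^(n - k - 1), the last factor being at most 1; cancelling t^k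
   leaves a bound linear in t. *)
rewrite exprMn -(subnKC kn) exprD exprSr => h.
rewrite -(ler_pM2l tk0).
rewrite (_ : t ^+ k * _ = m * (t ^+ k * (c - a) ^+ k / k`!%:R)); last by ring.
apply: (le_trans h); rewrite -!mulrA ler_pM2l// (mulrC _ t) ler_pM2l//.
by rewrite ler_piMl// exprn_ile1// (ltW t0).
Qed.

(** The third condition of [APset] reads (n - 1) w_1 <= w_2 (c - x): it is [alternating_homogeneity]
    for the sequence starting at w_1, whose first n - 1 terms vanish at c. *)
Lemma vanishing_APset n u : (1 < n)%N -> vanishing_Uset n a c u ->
  APset n a c u.
Proof.
case: n => [//|n] n1 Ku; have [Uu _] := Ku.
have Au := Uset_alternating ac Uu; have [_ _ w0] := Au.
have uc := alternating_derivs_vanish Ku.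
split; first split.
- by case: Uu => -[du _] _ k k2; apply: du; rewrite (leq_trans k2).
- by have [] := Uset_has_deriv Uu n1.
- move=> x xac.
  have := w0 1%N isT x xac; have := w0 2%N (leq_trans n1 (leqnSn _)) x xac.
  have := @alternating_homogeneity _ _ _ n n _ (alternatingS Au) (leqnn n)
    (fun k => uc k.+1) x xac.
  rewrite /alternating_derivs sqrrN expr1 expr1n mul1r mulN1r opprK => h1 h2 h3.
  split=> //; first by rewrite -oppr_ge0.
  by rewrite -[n.+1]addn1 natrD addrK; lra.
Qed.

(** The third condition at x = c gives w_1(c) = 0. For n = 3 let m = w_2(c): from w_1 >= m (c - x)
    and 2 w_1 <= w_2 (c - x) one gets 2 m <= w_2(c - s), while w_2(c - s) <= m + w_3(a) s; letting s
    tend to 0 gives m = 0. *)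
Lemma APset_vanishing n u : (1 < n <= 3)%N -> Uset n a c u -> APset n a c u ->
  vanishing_Uset n a c u.
Proof.
case: n => [//|n] /andP[n1 n3] Uu [_ APu].
have Au := Uset_alternating ac Uu; have [_ _ w0] := Au.
set w := alternating_derivs a c u in Au w0.
have {}APu x : x \in `[a, c] -> n%:R * w 1%N x <= w 2%N x * (c - x).
  move=> xac; have [_ _] := APu x xac.
  rewrite -[n.+1]addn1 natrD addrK /w /alternating_derivs.
  by rewrite sqrrN expr1 expr1n mul1r mulN1r opprK => h; lra.
apply: vanishing_UsetP => // k /andP[k0 kn].
rewrite -/w; clearbody w.
have n0 : 0 < n%:R :> R by rewrite ltr0n.
(* The index has been lowered by one, so [n = 2] is the case of [Uset 3]. *)
have : k = 1%N \/ k = 2%N /\ n = 2%N.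
  by case: n k {APu Uu Au w0 n0} n1 n3 k0 kn => [|[|[|]]] [|[|[|]]]; auto.
case=> [->|[-> nE]].
  by have := APu c cac; rewrite subrr mulr0 pmulr_rle0.
subst n; set m := w 2%N c.
have m0 : 0 <= m by apply: w0.
have wdec := alternating_nonincreasing Au.
have lb : {in `[a, c], forall x, m * ((c - x) ^+ 1 / 1`!%:R) <= w 1%N x}.
  apply: (alternating_lower_bound ac (alternatingS Au)) => // x xac.
  by apply: wdec => //; exact: lec.
apply: (@le0_linear_bound _ _ (w 3%N a) (c - a)); rewrite ?subr_gt0//.
  exact: w0.
move=> s s0 sca; have xac : c - s \in `[a, c].
  by rewrite in_itv/=; apply/andP; split; lra.
have := APu _ xac; have := lb _ xac.
rewrite expr1 (_ : 1`! = 1%N)// divr1 subKr => h1 h2.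
have h3 : 2 * m <= w 2%N (c - s).
  rewrite -(ler_pM2r s0); apply: le_trans h2; rewrite -mulrA ler_wpM2l//.
have [dw _ _] := Au.
(* The increment of w_2 over [c - s, c] is controlled by w_3, which is largest at a. *)
have [|z zac] := has_deriv_MVT (dw 2%N isT) xac cac; first lra.
rewrite subKr.
have zac' : z \in `[a, c].
  by move: xac zac; rewrite !in_itv/=; lra.
have : w 3%N z <= w 3%N a.
  by apply: wdec => //; move: zac'; rewrite in_itv/= => /andP[].
move=> /(ler_wpM2r (ltW s0)); rewrite -/m => h4 h5; lra.
Qed.

End vanishing.

(** * Approximation by truncated powers *)

(** A pair consists of a knot and a weight. The factorial lets differentiation lower the exponent,
    from 2 on, while keeping the same list. *)
Definition ramp_comb (R : realType) (n : nat) (L : seq (R * R)) (x : R) : R :=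
  \sum_(p <- L) p.2 * (Num.max (p.1 - x) 0 ^+ n / n`!%:R).

Lemma maxr0_le0 (R : realType) (x : R) : x <= 0 -> Num.max x 0 = 0.
Proof. by move=> x0; rewrite max_r. Qed.

Lemma maxr0_ge0 (R : realType) (x : R) : 0 <= Num.max x 0.
Proof. by rewrite le_max lexx orbT. Qed.

(* The square is handled from the definition, as max(x, 0) itself is not
   differentiable at 0; higher powers follow by the product rule. *)
Lemma is_derive_maxr0X (R : realType) (n : nat) (x : R) :
  is_derive x 1 (fun y => Num.max y 0 ^+ n.+2) (n.+2%:R * Num.max x 0 ^+ n.+1).
Proof.
elim: n => [|n IH]; last first.
  have -> : (fun y : R => Num.max y 0 ^+ n.+3) =
      (id * (fun y => Num.max y 0 ^+ n.+2)).
    apply/funext => y; rewrite !fctE exprS.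
    by case: (leP y 0) => y0; rewrite ?expr0n/= ?mul0r ?mulr0.
  apply: (is_derive_eq (is_deriveM (is_derive_id x 1) IH)).
  rewrite -![_ *: _]/(_ * _) mulr1 mulrCA.
  have -> : x * Num.max x 0 ^+ n.+1 = Num.max x 0 ^+ n.+2.
    rewrite [in RHS]exprS.
    by case: (leP x 0) => y0; rewrite ?expr0n/= ?mul0r ?mulr0.
  by rewrite -[n.+3%:R]natr1 [RHS]mulrDl mul1r.
apply: (@diffquot_is_derive _ (x - 1) (x + 1)).
  by rewrite in_itv/=; apply/andP; split; lra.
apply/diffquot_cvgP => e e0; exists e => // y _ yx xye.
rewrite (le_trans _ (ltW xye))// /diffquot expr1.
have yxp : 0 < `|y - x| by rewrite normr_gt0 subr_eq0.
have yx1 : y - x != 0 by rewrite subr_eq0.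
rewrite -(ler_pM2r yxp) -normrM mulrBl divfK// (distrC x y).
rewrite -[leRHS]expr2 real_normK ?num_real// ler_norml !expr2.
by case: (leP x 0) => x0; case: (leP y 0) => y0; apply/andP; split; nra.
Qed.

Section ramp_comb_theory.
Context (R : realType) (a c : R).
Implicit Types (L : seq (R * R)) (w : nat -> R -> R).

Lemma ramp_comb_cons n p L (x : R) :
  ramp_comb n (p :: L) x =
  p.2 * (Num.max (p.1 - x) 0 ^+ n / n`!%:R) + ramp_comb n L x.
Proof. by rewrite /ramp_comb big_cons. Qed.

Lemma is_derive_ramp n (s x : R) :
  is_derive x 1 (fun y => Num.max (s - y) 0 ^+ n.+2)
    (- (n.+2%:R * Num.max (s - x) 0 ^+ n.+1)).
Proof.
have ds : is_derive x 1 (fun y => s - y) (-1).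
  have -> : (fun y => s - y) = cst s - id by apply/funext => y; rewrite fctE.
  by apply: is_derive_eq; rewrite sub0r.
have := @is_derive1_comp R (fun y => Num.max y 0 ^+ n.+2) (fun y => s - y)
  x _ _ (is_derive_maxr0X n (s - x)) ds.
by move=> h; apply: (is_derive_eq h); rewrite mulrN1.
Qed.

Lemma has_deriv_ramp_comb n L :
  has_deriv a c (ramp_comb n.+2 L) (fun x => - ramp_comb n.+1 L x).
Proof.
elim: L => [|p L IH].
  have -> : ramp_comb n.+2 [::] = cst (0 : R).
    by apply/funext => x; rewrite /ramp_comb big_nil.
  apply: has_deriv_eq (is_derive_has_deriv a c
      (fun x => is_derive_cst (0 : R) x 1)) => x _.
  by rewrite /ramp_comb big_nil oppr0.
have -> : ramp_comb n.+2 (p :: L) = (fun x => (p.2 / n.+2`!%:R) *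
    Num.max (p.1 - x) 0 ^+ n.+2) \+ ramp_comb n.+2 L.
  by apply/funext => x; rewrite ramp_comb_cons /=; congr (_ + _); ring.
have dp := has_derivZ (p.2 / n.+2`!%:R)
  (is_derive_has_deriv a c (is_derive_ramp n p.1)).
apply: has_deriv_eq (has_derivD dp IH) => x _ /=.
rewrite ramp_comb_cons opprD -(invf_factS R n.+1); congr (_ + _); ring.
Qed.

(** The approximant is piecewise affine, with slope -w_1 at the right node of each piece. Since w_1
    is Lipschitz with constant M = max w_2, short pieces keep the slope error below e. *)
Lemma ramp_comb_approx1 w (e : R) : a < c -> alternating a c 1 w ->
  w 0%N c = 0 -> 0 < e ->
  exists L, (forall p, p \in L -> p.1 \in `[a, c] /\ 0 <= p.2) /\
    {in `[a, c], forall x, `|w 0%N x - ramp_comb 1 L x| <= e * (c - x)}.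
Proof.
move=> ac [dw cw w0] wc e0.
have [dw0 dw1] : has_deriv a c (w 0%N) (fun x => - w 1%N x) /\
    has_deriv a c (w 1%N) (fun x => - w 2%N x) by split; exact: dw.
have [z zac zM] := EVT_max (ltW ac) cw.
have M0 : 0 <= w 2%N z by rewrite w0.
set M := w 2%N z in zM M0.
have w1dec x y : x \in `[a, c] -> y \in `[a, c] -> x <= y ->
    0 <= w 1%N x - w 1%N y <= M * (y - x).
  move=> xac yac xy; have [r rxy] := has_deriv_MVT dw1 xac yac xy.
  have rac : r \in `[a, c].
    by move: xac yac rxy; rewrite !in_itv/=; lra.
  have := zM r rac; have := w0 2%N isT r rac => h1 h2 h3.
  have h4 : 0 <= w 2%N r * (y - x) <= M * (y - x).
    by rewrite mulr_ge0 ?subr_ge0//= ler_wpM2r ?subr_ge0.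
  lra.
(* Invariant of a grid moving left from c. The sum of the weights is minus the slope with which the
   combination continues to the left of s. *)
pose Q s := exists L, [/\ forall p, p \in L -> p.1 \in `[s, c] /\ 0 <= p.2,
  \sum_(p <- L) p.2 = w 1%N s &
  forall x, x \in `[s, c] -> `|w 0%N x - ramp_comb 1 L x| <= e * (c - x)].
have step s s' : s \in `[a, c] -> s' \in `[a, c] -> s' <= s ->
    M * (s - s') <= e -> Q s -> Q s'.
  move=> sac s'ac s's Ms [L [Lac Ls LQ]].
  exists ((s', w 1%N s' - w 1%N s) :: L); split.
  - move=> p; rewrite inE => /predU1P[->/=|pL]; last first.
      have [] := Lac p pL; rewrite !in_itv/= => /andP[sp pc] p0.
      by rewrite (le_trans s's sp) pc.
    have /andP[-> _] := w1dec _ _ s'ac sac s's.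
    by move: s'ac; rewrite !in_itv/= lexx => /andP[_ ->].
  - by rewrite big_cons Ls /= subrK.
  - move=> x xs'; rewrite ramp_comb_cons.
    have -> : Num.max (s' - x) 0 = 0.
      by rewrite maxr0_le0// subr_le0; move: xs'; rewrite in_itv/= => /andP[].
    rewrite mul0r mulr0 add0r.
    have [sx|xs] := leP s x.
      by apply: LQ; move: xs'; rewrite !in_itv/= sx => /andP[].
    have xac : x \in `[a, c] by move: xs' s'ac; rewrite !in_itv/=; lra.
    (* All knots of L lie to the right of s, so no maximum is truncated here and the combination is
       affine. *)
    have -> : ramp_comb 1 L x = ramp_comb 1 L s + w 1%N s * (s - x).
      rewrite -Ls /ramp_comb mulr_suml -big_split/=.
      apply: eq_big_seq => p /Lac[]; rewrite in_itv/= => /andP[sp _] _.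
      rewrite !max_l ?subr_ge0// ?(le_trans (ltW xs))// !expr1 !divr1.
      ring.
    have scc : s \in `[s, c] by move: sac; rewrite !in_itv/= lexx => /andP[].
    have := LQ s scc.
    have [r rxs] := has_deriv_MVT dw0 xac sac (ltW xs).
    have rac : r \in `[a, c].
      by move: xac sac rxs; rewrite !in_itv/=; lra.
    have rs : r <= s by move: rxs; rewrite in_itv/= => /andP[].
    have s'r : s' <= r by move: rxs xs'; rewrite !in_itv/=; lra.
    have := w1dec r s rac sac rs.
    have Mrs : M * (s - r) <= M * (s - s') by rewrite ler_wpM2l// lerD2l lerN2.
    move: (w 1%N r) (w 1%N s) (w 0%N s) (w 0%N x) (ramp_comb 1 L s).
    move=> w1r w1s w0s w0x l /andP[h1 h2] h3.
    have h4 : 0 <= (w1r - w1s) * (s - x) <= e * (s - x).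
      have sx0 : 0 <= s - x by rewrite subr_ge0 ltW.
      by apply/andP; split; [rewrite mulr_ge0|apply: ler_wpM2r => //; lra].
    by rewrite !ler_norml => /andP[h5 h6]; apply/andP; split; lra.
have cac : c \in `[a, c] by rewrite in_itv/= lexx ltW.
have Qc : Q c.
  exists [:: (c, w 1%N c)]; split.
  - by move=> p; rewrite inE => /eqP->/=; rewrite in_itv/= lexx w0.
  - by rewrite big_seq1.
  - move=> x; rewrite in_itv/= => /andP[cx xc].
    have -> : x = c by apply: le_anti; rewrite xc cx.
    rewrite /ramp_comb big_seq1/= wc subrr maxr0_le0// mul0r mulr0 subr0.
    by rewrite normr0 mulr0.
(* Adding 1 covers the case M = 0. *)
pose d := e / (M + 1).
have M1 : 0 < M + 1 by rewrite ltr_wpDl.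
have d0 : 0 < d by rewrite divr_gt0.
have Md : M * d <= e.
  by rewrite /d mulrCA ler_piMr ?(ltW e0)// ler_pdivrMr// mul1r lerDl.
(* Truncating the nodes at a makes the last one equal to a. *)
have Qk k : Q (Num.max a (c - k%:R * d)).
  elim: k => [|k IHk]; first by rewrite mul0r subr0 max_r// ltW.
  apply: step IHk.
  - rewrite in_itv/= le_max lexx/= ge_max (ltW ac)/=.
    by rewrite gerBl mulr_ge0// ltW.
  - rewrite in_itv/= le_max lexx/= ge_max (ltW ac)/=.
    by rewrite gerBl mulr_ge0// ltW.
  - rewrite ge_max le_max lexx/= le_max; apply/orP; right.
    by rewrite lerD2l lerN2 -natr1 mulrDl mul1r lerDl ltW.
  - apply: le_trans Md; rewrite ler_wpM2l// -natr1 mulrDl mul1r.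
    by case: (leP a (c - k%:R * d)) => ?;
      case: (leP a (c - (k%:R * d + d))) => ?; lra.
have [k kd] : exists k : nat, c - a <= k%:R * d.
  exists (Num.bound ((c - a) / d)).
  by rewrite -ler_pdivrMr// ltW// archi_boundP// divr_ge0 ?subr_ge0 ?ltW.
have [L [LQ _ L0]] := Qk k.
rewrite max_l in LQ L0; last lra.
by exists L.
Qed.

(** A list approximating w_1 within e / (c - a) also approximates w_0 within e, one exponent higher:
    both sides vanish at c, and the error is integrated from there. *)
Lemma ramp_comb_approx n w (e : R) : a < c -> alternating a c n.+1 w ->
  (forall k, (k < n.+1)%N -> w k c = 0) -> 0 < e ->
  exists L, (forall p, p \in L -> p.1 \in `[a, c] /\ 0 <= p.2) /\
    {in `[a, c], forall x, `|w 0%N x - ramp_comb n.+1 L x| <= e}.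
Proof.
move=> ac; have ca0 : 0 < c - a by rewrite subr_gt0.
elim: n w e => [|n IH] w e Aw wc e0.
  have [L [Lac LQ]] := ramp_comb_approx1 ac Aw (wc 0%N isT)
    (divr_gt0 e0 ca0).
  exists L; split=> // x xac; apply: (le_trans (LQ x xac)).
  rewrite -mulrA ler_piMr ?(ltW e0)// mulrC ler_pdivrMr// mul1r lerD2l lerN2.
  by move: xac; rewrite in_itv/= => /andP[].
have [L [Lac LQ]] := IH _ _ (alternatingS Aw) (fun k => wc k.+1)
  (divr_gt0 e0 ca0).
exists L; split=> // x xac; case: Aw => dw _ _.
rewrite -[leRHS](divfK (lt0r_neq0 ca0)).
apply: (has_deriv_bound
  (has_derivB (dw 0%N isT) (has_deriv_ramp_comb n L))) => //=.
- by rewrite ltW// divr_gt0.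
- move=> y yac; rewrite opprK addrC -opprB normrN.
  by apply: LQ; exact: subset_itv_oo_cc yac.
- rewrite wc// sub0r /ramp_comb big_seq big1 ?oppr0// => p /Lac[].
  rewrite in_itv/= => /andP[_ pc] _.
  by rewrite maxr0_le0 ?subr_le0// expr0n/= mul0r mulr0.
Qed.

End ramp_comb_theory.

(** * Minkowski's inequality and convexity of the root *)

Lemma exprn_convex (R : realFieldType) (n : nat) (t x y : R) :
  0 <= t <= 1 -> 0 <= x -> 0 <= y ->
  (t * x + (1 - t) * y) ^+ n <= t * x ^+ n + (1 - t) * y ^+ n.
Proof.
move=> /andP[t0 t1] x0 y0; elim: n => [|n IH]; first by rewrite !expr0; lra.
have s0 : 0 <= t * x + (1 - t) * y.
  by rewrite addr_ge0// mulr_ge0// subr_ge0.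
rewrite exprS; apply: (le_trans (ler_wpM2l s0 IH)); rewrite !exprS -subr_ge0.
have h : 0 <= (x - y) * (x ^+ n - y ^+ n).
  have [xy|/ltW yx] := leP x y.
    by rewrite mulr_le0// subr_le0// lerXn2r// nnegrE.
  by rewrite mulr_ge0// subr_ge0// lerXn2r// nnegrE.
(* The two differences have the same sign, as powers are monotone. *)
rewrite (_ : _ - _ = t * (1 - t) * ((x - y) * (x ^+ n - y ^+ n))); last by ring.
by rewrite mulr_ge0// mulr_ge0// subr_ge0.
Qed.

(** Serves to absorb an additive error h^n into a shift of the n-th root by h. *)
Lemma exprn_superadd (R : realFieldType) (n : nat) (x y : R) : (0 < n)%N ->
  0 <= x -> 0 <= y -> x ^+ n + y ^+ n <= (x + y) ^+ n.
Proof.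
case: n => // n _ x0 y0; elim: n => [|n IH]; first by rewrite !expr1.
rewrite exprS [in y ^+ _]exprS [leRHS]exprS.
have xn : 0 <= x ^+ n.+1 by rewrite exprn_ge0.
have yn : 0 <= y ^+ n.+1 by rewrite exprn_ge0.
apply: le_trans (ler_wpM2l (addr_ge0 x0 y0) IH).
have := mulr_ge0 x0 yn; have := mulr_ge0 y0 xn; lra.
Qed.

(* Minkowski's inequality for the n-th root of [ramp_comb n L], in a form that
   avoids the root: rescale the two points by A and B and use that the n-th
   power is convex. *)
Lemma ramp_comb_minkowski (R : realType) (n : nat) (L : seq (R * R))
    (t x y A B : R) : (forall p, p \in L -> 0 <= p.2) ->
  0 <= t <= 1 -> 0 < A -> 0 < B ->
  ramp_comb n L x <= A ^+ n -> ramp_comb n L y <= B ^+ n ->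
  ramp_comb n L (t * x + (1 - t) * y) <= (t * A + (1 - t) * B) ^+ n.
Proof.
move=> L0 t01 A0 B0 xA yB; have /andP[t0 t1] := t01.
set S := t * A + (1 - t) * B.
have S0 : 0 < S.
  have [tE|tE] := eqVneq t 0; first by rewrite /S tE; lra.
  have tA : 0 < t * A by rewrite mulr_gt0// lt_neqAle eq_sym tE.
  have tB : 0 <= (1 - t) * B by rewrite mulr_ge0 ?(ltW B0)// subr_ge0.
  by rewrite /S; lra.
(* For this weight, S (u P / A + (1 - u) Q / B) = t P + (1 - t) Q. *)
pose u := t * A / S.
have uE : 1 - u = (1 - t) * B / S.
  rewrite /u -{1}(divff (lt0r_neq0 S0)) -mulrBl; congr (_ / _).
  by rewrite /S; ring.
have u01 : 0 <= u <= 1.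
  rewrite divr_ge0 ?(mulr_ge0 t0) ?(ltW A0) ?(ltW S0)//=.
  by rewrite -subr_ge0 uE divr_ge0 ?(ltW S0)// mulr_ge0 ?(ltW B0)// subr_ge0.
have An0 : 0 < A ^+ n by rewrite exprn_gt0.
have Bn0 : 0 < B ^+ n by rewrite exprn_gt0.
apply: (@le_trans _ _ (S ^+ n * (u * (ramp_comb n L x / A ^+ n) +
    (1 - u) * (ramp_comb n L y / B ^+ n)))).
  rewrite /ramp_comb !mulr_suml !mulr_sumr -big_split mulr_sumr/=.
  rewrite big_seq [leRHS]big_seq; apply: ler_sum => p /L0 p0.
  set P := Num.max (p.1 - x) 0; set Q := Num.max (p.1 - y) 0.
  have P0 : 0 <= P by exact: maxr0_ge0.
  have Q0 : 0 <= Q by exact: maxr0_ge0.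
  have h1 : Num.max (p.1 - (t * x + (1 - t) * y)) 0 <=
      S * (u * (P / A) + (1 - u) * (Q / B)).
    rewrite uE /u (_ : S * _ = t * P + (1 - t) * Q); last first.
      by field; rewrite ?(lt0r_neq0 A0) ?(lt0r_neq0 B0) ?(lt0r_neq0 S0).
    rewrite ge_max addr_ge0 ?mulr_ge0 ?subr_ge0// andbT.
    have Px : p.1 - x <= P by rewrite /P le_max lexx.
    have Qy : p.1 - y <= Q by rewrite /Q le_max lexx.
    have t10 : 0 <= 1 - t by rewrite subr_ge0.
    have := ler_wpM2l t0 Px; have := ler_wpM2l t10 Qy; lra.
  have h2 : Num.max (p.1 - (t * x + (1 - t) * y)) 0 ^+ n <=
      S ^+ n * (u * (P ^+ n / A ^+ n) + (1 - u) * (Q ^+ n / B ^+ n)).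
    rewrite -!expr_div_n.
    apply: le_trans (ler_wpM2l _ (exprn_convex n u01 _ _)).
    - rewrite -exprMn lerXn2r// nnegrE ?maxr0_ge0//.
      by apply: le_trans h1; exact: maxr0_ge0.
    - by rewrite exprn_ge0// ltW.
    - by rewrite divr_ge0// ltW.
    - by rewrite divr_ge0// ltW.
  have f0 : 0 <= p.2 / n`!%:R by rewrite divr_ge0.
  have := ler_wpM2l f0 h2; lra.
rewrite ler_piMr ?exprn_ge0 ?(ltW S0)//.
have /andP[u0 u1] := u01.
have h1 : u * (ramp_comb n L x / A ^+ n) <= u.
  by rewrite ler_piMr// ler_pdivrMr// mul1r.
have h2 : (1 - u) * (ramp_comb n L y / B ^+ n) <= 1 - u.
  by rewrite ler_piMr ?subr_ge0// ler_pdivrMr// mul1r.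
lra.
Qed.

(** Minkowski's inequality holds for combinations of ramps, and w_0 is within h^n of one;
    superadditivity of the power turns this into an error h on the root. *)
Lemma vanishing_LPset (R : realType) (a c : R) (n : nat) (u : R -> R) :
  a < c -> (0 < n)%N -> vanishing_Uset n a c u -> LPset n a c u.
Proof.
move=> ac n0 Ku; have [Uu _] := Ku.
have unc := Uset_nondecreasing Uu.
have cac : c \in `[a, c] by rewrite in_itv/= lexx ltW.
have ulec x : x \in `[a, c] -> u x <= u c.
  by move=> xac; apply: unc => //; move: xac; rewrite in_itv/= => /andP[].
have inv0 : 0 <= (n%:R^-1 : R) by rewrite invr_ge0.
split=> //; last first.
  move=> x y xac yac yx; apply: ge0_ler_powR => //.
  - by rewrite nnegrE subr_ge0 ulec.
  - by rewrite nnegrE subr_ge0 ulec.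
  - by rewrite lerD2l lerN2 unc.
move=> t x y; rewrite !inE => xac yac; rewrite !convRE /=.
have s01 : 0 <= t%:num <= 1 by apply/andP; split; [exact: ge0|exact: le1].
set s := t%:num in s01 *; have /andP[s0 s1] := s01.
set z := s * x + (1 - s) * y.
have zac : z \in `[a, c].
  have s1' : 0 <= 1 - s by rewrite subr_ge0.
  move: xac yac; rewrite !in_itv/= => /andP[ax xc] /andP[ay yc].
  have := ler_wpM2l s0 ax; have := ler_wpM2l s1' ay.
  have := ler_wpM2l s0 xc; have := ler_wpM2l s1' yc.
  by rewrite /z => h1 h2 h3 h4; apply/andP; split; lra.
have v0 r : r \in `[a, c] -> 0 <= u c - u r by move=> ?; rewrite subr_ge0 ulec.
set f := fun r : R => (u c - u r) `^ n%:R^-1.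
have f0 r : 0 <= f r by rewrite powR_ge0.
have fX r : r \in `[a, c] -> f r ^+ n = u c - u r.
  by move=> rac; rewrite /f root_exprK// v0.
rewrite -/(f x) -/(f y) -/(f z).
(* One h is spent at x and y, the other at z. The shift by h also makes the bounds positive, as
   [ramp_comb_minkowski] requires. *)
apply/ler_addgt0Pr => e e0; pose h := e / 2.
have h0 : 0 < h by rewrite divr_gt0.
have hn0 : 0 < h ^+ n by rewrite exprn_gt0.
have [L [L0 LQ]] : exists L, (forall p, p \in L -> 0 <= p.2) /\
    {in `[a, c], forall r, `|u c - u r - ramp_comb n L r| <= h ^+ n}.
  move: Ku n0 hn0; case: (n) => // m Km _ hm0.
  have [|L [L0 LQ]] := ramp_comb_approx ac (Uset_alternating ac Km.1) _ hm0.
    exact: alternating_derivs_vanish.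
  by exists L; split=> // p /L0[].
have approx r : r \in `[a, c] -> ramp_comb n L r <= (f r + h) ^+ n.
  move=> rac; apply: le_trans (exprn_superadd n0 (f0 r) (ltW h0)).
  by rewrite fX//; have := LQ r rac; rewrite ler_norml => /andP[]; lra.
have := ramp_comb_minkowski L0 s01 (ltr_wpDl (f0 x) h0) (ltr_wpDl (f0 y) h0)
  (approx x xac) (approx y yac).
rewrite -/z => hz.
have S0 : 0 <= s * (f x + h) + (1 - s) * (f y + h).
  by rewrite addr_ge0// mulr_ge0 ?subr_ge0// addr_ge0// ltW.
have : f z ^+ n <= (s * (f x + h) + (1 - s) * (f y + h) + h) ^+ n.
  apply: le_trans (exprn_superadd n0 S0 (ltW h0)); rewrite fX//.
  by have := LQ z zac; rewrite ler_norml => /andP[]; lra.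
rewrite ler_pXn2r ?nnegrE ?f0 ?(addr_ge0 S0 (ltW h0))//.
by have := splitr e; rewrite -/h /unstable.onem; lra.
Qed.

(** * Smooth test functions close to truncated powers *)

Lemma is_derive_ramp_comb (R : realType) (n : nat) (L : seq (R * R)) (x : R) :
  is_derive x 1 (ramp_comb n.+2 L) (- ramp_comb n.+1 L x).
Proof.
apply: (has_deriv_ramp_comb (x - 1) (x + 1) n L).2.
by rewrite in_itv/=; apply/andP; split; lra.
Qed.

Lemma continuous_ramp (R : realType) (n : nat) (s : R) :
  continuous (fun x : R => Num.max (s - x) 0 ^+ n).
Proof.
move=> x; apply: (@continuous_comp _ _ _ (fun y : R => Num.max (s - y) 0)
  (fun y => y ^+ n)); last exact: exprn_continuous.
apply: (@continuous_max _ R (fun y : R => s - y) (cst 0)).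
  by apply: continuousB; [exact: cst_continuous|by move=> ?; exact: cvg_id].
exact: cst_continuous.
Qed.

Lemma continuous_ramp_comb (R : realType) (n : nat) (L : seq (R * R)) :
  continuous (ramp_comb n L).
Proof.
elim: L => [|p L IH].
  have -> : ramp_comb n [::] = cst (0 : R).
    by apply/funext => x; rewrite /ramp_comb big_nil.
  exact: cst_continuous.
have -> : ramp_comb n (p :: L) = (fun x =>
    p.2 * (Num.max (p.1 - x) 0 ^+ n / n`!%:R) + ramp_comb n L x).
  by apply/funext => x; rewrite ramp_comb_cons.
move=> x; apply: cvgD; last exact: IH.
apply: cvgM; first exact: cvg_cst.
by apply: cvgM; [exact: continuous_ramp|exact: cvg_cst].
Qed.

Lemma exprn_lipschitz (R : realFieldType) (n : nat) (M : R) : 0 <= M ->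
  exists2 K, 0 <= K & forall x y, 0 <= y -> y <= x -> x <= M ->
    x ^+ n - y ^+ n <= K * (x - y).
Proof.
move=> M0; elim: n => [|n [K K0 IH]].
  by exists 0 => // x y _ _ _; rewrite !expr0 subrr mul0r.
exists (M * K + M ^+ n); first by rewrite addr_ge0 ?mulr_ge0 ?exprn_ge0.
move=> x y y0 yx xM; have x0 := le_trans y0 yx.
rewrite !exprS.
rewrite (_ : _ - _ = x * (x ^+ n - y ^+ n) + y ^+ n * (x - y)); last by ring.
have d0 : 0 <= x - y by rewrite subr_ge0.
have K1 : 0 <= K * (x - y) by rewrite mulr_ge0.
rewrite mulrDl lerD//.
  apply: (le_trans (ler_wpM2l x0 (IH x y y0 yx xM))).
  by rewrite -mulrA ler_wpM2r.
by rewrite ler_wpM2r// lerXn2r// ?nnegrE ?(le_trans yx).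
Qed.

Section test_functions.
Context (R : realType) (a c : R) (ac : a < c).

Let cac : c \in `[a, c]. Proof. by rewrite in_itv/= lexx ltW. Qed.

Lemma derivn_onE (U : nat -> R -> R) (N : nat) :
  (forall k (x : R), (k < N)%N -> is_derive x 1 (U k) (U k.+1 x)) ->
  forall k, (k <= N)%N -> {in `[a, c], derivn_on a c k (U 0%N) =1 U k}.
Proof.
move=> dU; elim=> [|k IH] kN x xac //.
have [_ E] := deriv_on_congr xac (IH (ltnW kN)).
rewrite [LHS]E; have dk := is_derive_diffquot a c (dU k x kN).
by have [] := deriv_on_eq ac xac dk.
Qed.

Lemma contdiff_on_iter (U : nat -> R -> R) (N : nat) :
  (forall k (x : R), (k < N)%N -> is_derive x 1 (U k) (U k.+1 x)) ->
  continuous (U N) -> contdiff_on a c N (U 0%N).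
Proof.
move=> dU cU; split.
  move=> k kN x xac.
  have [-> _] := deriv_on_congr xac (derivn_onE dU (ltnW kN)).
  have dk := is_derive_diffquot a c (dU k x kN).
  by have [] := deriv_on_eq ac xac dk.
apply: (@subspace_eq_continuous _ _ _ (U N)); last exact: continuous_subspaceT.
by move=> x; rewrite inE => xac; apply/esym/(derivn_onE dU (leqnn N)).
Qed.

(** A second difference of step e divided by e^2. With exponent 1 it gives the hat function of
    integral 1 supported in [t - 2 e, t]. *)
Definition hat_knots (t e : R) : seq (R * R) :=
  [:: (t, (e ^+ 2)^-1); (t - e, - (2 / e ^+ 2)); (t - e - e, (e ^+ 2)^-1)].

Lemma hat_knotsE n (t e x : R) : ramp_comb n (hat_knots t e) x =
  (Num.max (t - x) 0 ^+ n - 2 * Num.max (t - e - x) 0 ^+ n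
   + Num.max (t - e - e - x) 0 ^+ n) / e ^+ 2 / n`!%:R.
Proof. by rewrite /ramp_comb !big_cons big_nil /=; ring. Qed.

Lemma hat_knots_end n (t e : R) : 0 < e -> t <= c ->
  ramp_comb n.+1 (hat_knots t e) c = 0.
Proof.
move=> e0 tc; rewrite hat_knotsE !maxr0_le0; [|lra..].
by rewrite expr0n/= mulr0 subr0 addr0 !mul0r.
Qed.

(** One weight is negative, so positivity comes from the hat function, at exponent 1, and is
    integrated from c. *)
Lemma hat_knots_ge0 n (t e : R) : 0 < e -> t <= c ->
  {in `[a, c], forall x, 0 <= ramp_comb n.+1 (hat_knots t e) x}.
Proof.
move=> e0 tc; elim: n => [|n IH].
  move=> x _; rewrite hat_knotsE !expr1 divr1 divr_ge0 ?sqr_ge0//.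
  by case: (leP (t - x) 0); case: (leP (t - e - x) 0);
    case: (leP (t - e - e - x) 0); lra.
apply: (has_deriv_ge0 (has_deriv_ramp_comb a c n (hat_knots t e))).
  by move=> x xac; rewrite oppr_le0 IH//; exact: subset_itv_oo_cc xac.
by rewrite hat_knots_end.
Qed.

(** A second difference over e^2 is a second derivative at an intermediate point: the mean value
    theorem is used twice, first on the difference of two ramps, then on a single ramp. *)
Lemma hat_knots_between n (t e x : R) : 0 < e ->
  exists2 y, t - e - e <= y <= t & ramp_comb n.+3 (hat_knots t e) x =
    Num.max (y - x) 0 ^+ n.+1 / n.+1`!%:R.
Proof.
move=> e0.
have xx : x \in `[x, x + e] by rewrite in_itv/= lexx lerDl ltW.
have xex : x + e \in `[x, x + e] by rewrite in_itv/= lexx lerDl ltW.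
have xe : x <= x + e by rewrite lerDl ltW.
have [z zx Pz] := has_deriv_MVT
  (has_deriv_ramp_comb x (x + e) n.+1 [:: (t, 1); (t - e, -1)]) xx xex xe.
have zz : z \in `[z, z + e] by rewrite in_itv/= lexx lerDl ltW.
have zez : z + e \in `[z, z + e] by rewrite in_itv/= lexx lerDl ltW.
have ze : z <= z + e by rewrite lerDl ltW.
have [r rz Pr] := has_deriv_MVT
  (has_deriv_ramp_comb z (z + e) n [:: (t, 1)]) zz zez ze.
(* The point r lies in [x, x + 2 e], and y is chosen so that y - x = t - r. *)
exists (t - r + x).
  by move: zx rz; rewrite !in_itv/=; lra.
move: Pz Pr; rewrite hat_knotsE /ramp_comb !big_cons !big_nil /=.
rewrite !(addrAC x e) !subrr !add0r !(addrAC z e) !subrr !add0r.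
rewrite !opprD !addrA !addr0 !mul1r !mulN1r !addrK.
rewrite !(addrAC t (- x) (- e)) !(addrAC t (- z) (- e)).
rewrite !(addrAC (t - e) (- x) (- e)).
set A := Num.max (t - x) 0 ^+ _; set B := Num.max (t - e - x) 0 ^+ _.
set C := Num.max (t - e - e - x) 0 ^+ _.
set A' := Num.max (t - z) 0 ^+ _; set B' := Num.max (t - e - z) 0 ^+ _.
set D := Num.max (t - r) 0 ^+ _.
set f3 := n.+3`!%:R; set f2 := n.+2`!%:R; set f1 := n.+1`!%:R.
clearbody A B C A' B' D f1 f2 f3 => Pz Pr.
have E1 : A / f3 - 2 * (B / f3) + C / f3 = (A' / f2 - B' / f2) * e by lra.
have E2 : A' / f2 - B' / f2 = D / f1 * e by lra.
rewrite (_ : _ / f3 = (A / f3 - 2 * (B / f3) + C / f3) / e ^+ 2); last by ring.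
rewrite E1 E2 (_ : _ * e * e = D / f1 * e ^+ 2); last by ring.
by rewrite mulfK// expf_neq0// lt0r_neq0.
Qed.

(** Minus the hat combination of exponent n + 3 is smooth enough for [Uset n.+1], and it equals
    minus a truncated power of exponent n + 1 whose knot is within 2 e of t. *)
Lemma ramp_approx n (t d : R) : t \in `[a, c] -> 0 < d ->
  exists2 u, vanishing_Uset n.+1 a c u &
    {in `[a, c], forall x, `|u x + Num.max (t - x) 0 ^+ n.+1 / n.+1`!%:R| <= d}.
Proof.
rewrite in_itv/= => /andP[at_ tc] d0.
have ca0 : 0 <= c - a by rewrite subr_ge0 ltW.
have [K K0 Klip] := exprn_lipschitz n.+1 ca0.
(* Moving the knot by at most 2 e costs at most 2 K e <= d; adding 1 covers K = 0. *)
pose e := d / (2 * (K + 1)).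
have K1 : 0 < 2 * (K + 1) by rewrite mulr_gt0// ltr_wpDl.
have e0 : 0 < e by rewrite divr_gt0.
have Ked : K * (2 * e) <= d.
  have : (K + 1) * (2 * e) = d.
    by rewrite /e; field; rewrite lt0r_neq0// ltr_wpDl.
  by rewrite mulrDl; move: e0; lra.
pose L := hat_knots t e.
(* The successive derivatives; the last one, for k = n + 2, has exponent 1 and is the continuous hat
   function up to sign. *)
pose U k : R -> R := fun x => - ((-1) ^+ k * ramp_comb (n.+3 - k) L x).
have dU k (x : R) : (k < n.+2)%N -> is_derive x 1 (U k) (U k.+1 x).
  move=> kn; have -> : U k = (- (-1) ^+ k) \*: ramp_comb (n.+1 - k).+2 L.
    apply/funext => y; rewrite /U -[RHS]/(_ * _) mulNr.
    by rewrite -!subSn// ltnW.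
  apply: (is_derive_eq (is_deriveZ _ (is_derive_ramp_comb (n.+1 - k) L x))).
  rewrite /U exprS -[_ *: _]/(_ * _) -subSn; last exact: kn.
  by rewrite !mulNr mulrN !opprK mul1r.
have cU : continuous (U n.+2).
  rewrite /U -[n.+3]addn1 addKn => x; apply: cvgN; apply: cvgM.
    exact: cvg_cst.
  exact: continuous_ramp_comb.
have UE := derivn_onE dU.
exists (U 0%N).
- split; first split.
  + exact: contdiff_on_iter.
  + move=> x xac k /andP[_ kn]; rewrite UE// /U mulrN mulrA -expr2 sqrr_sign.
    rewrite mul1r oppr_le0 -[(n.+3 - k)%N]prednK ?subn_gt0//.
    exact: hat_knots_ge0.
  + move=> k /andP[k0 kn]; rewrite UE// /U; last by rewrite ltnW// ltnW.
    rewrite -[(n.+3 - k)%N]prednK ?subn_gt0 ?hat_knots_end ?mulr0 ?oppr0//.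
    by rewrite ltnW// ltnW.
- move=> x xac; have [y /andP[ty yt]] := hat_knots_between n t x e0.
  rewrite /U subn0 expr0 mul1r => ->.
  move: xac; rewrite in_itv/= => /andP[ax xc].
  rewrite addrC -mulrBl.
  have mm : Num.max (y - x) 0 <= Num.max (t - x) 0.
    by case: (leP (y - x) 0); case: (leP (t - x) 0); lra.
  have f0 : 0 < n.+1`!%:R :> R by rewrite ltr0n fact_gt0.
  rewrite ger0_norm; last first.
    by rewrite divr_ge0 ?(ltW f0)// subr_ge0 lerXn2r// nnegrE maxr0_ge0.
  rewrite ler_pdivrMr//.
  apply: (@le_trans _ _ (K * (2 * e))).
    apply: (le_trans (Klip _ _ (maxr0_ge0 _) mm _)).
      by rewrite ge_max ca0 andbT; lra.
    rewrite ler_wpM2l//.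
    by case: (leP (y - x) 0); case: (leP (t - x) 0); move: e0; lra.
  by rewrite (le_trans Ked)// ler_peMr ?(ltW d0)// ler1n fact_gt0.
Qed.

End test_functions.

(** * Integrals and lower partial moments *)

Section integral_dF_theory.
Context (R : realType) (a b : R) (F : cumulativeBounded (0 : R) (1 : R)).
Context (hF : supported_on a b F).
Implicit Types f g : R -> R.

Let mu := lebesgue_stieltjes_measure F.

Let mab : measurable (`[a, b] : set (measurableTypeR R)).
Proof. exact: measurable_itv. Qed.

Lemma integrable_dF f : {within `[a, b], continuous f} ->
  mu.-integrable `[a, b] (EFin \o f).
Proof.
move=> cf; apply: measurable_bounded_integrable => //.
- have mu1 := probability_le1 (lebesgue_stieltjes_measure F) mab.
  by apply: (le_lt_trans mu1); rewrite ltry.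
- by apply: subspace_continuous_measurable_fun.
- have /compact_bounded[M [_ mrt]] :=
    continuous_compact cf (@segment_compact _ a b).
  by exists M; split; rewrite ?num_real // => ? ? ? ?; exact: mrt.
Qed.

Lemma dF_itv : mu `[a, b] = 1%E.
Proof.
have muT : mu setT = 1%E := probability_setT (lebesgue_stieltjes_measure F).
have mu0 : mu (~` `[a, b]) = 0%E := hF.
have muU := measureU mu mab (measurableC mab) (setICr _).
move: muU; rewrite setUv [X in (_ + X)%E]mu0 adde0 => E.
exact: (etrans (esym E) muT).
Qed.

Lemma integral_dF_cst (k : R) : integral_dF a b F (fun=> k) = k.
Proof.
rewrite /integral_dF Rintegral_cst// -[RHS]mulr1.
have mu1 : fine (mu `[a, b]) = 1 by rewrite dF_itv.
by congr (_ * _); exact: mu1.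
Qed.

Lemma integral_dFD f g : {within `[a, b], continuous f} ->
  {within `[a, b], continuous g} ->
  integral_dF a b F (fun x => f x + g x) =
  integral_dF a b F f + integral_dF a b F g.
Proof. by move=> cf cg; apply: RintegralD => //; exact: integrable_dF. Qed.

Lemma integral_dFZ (k : R) f : {within `[a, b], continuous f} ->
  integral_dF a b F (fun x => k * f x) = k * integral_dF a b F f.
Proof. by move=> cf; apply: RintegralZl => //; exact: integrable_dF. Qed.

Lemma le_integral_dF f g : {within `[a, b], continuous f} ->
  {within `[a, b], continuous g} -> {in `[a, b], forall x, f x <= g x} ->
  integral_dF a b F f <= integral_dF a b F g.
Proof.
by move=> cf cg fg; apply: le_Rintegral => //; exact: integrable_dF.
Qed.

(** No factor appears in front of e, as [a, b] has mass 1. *)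
Lemma integral_dF_close f g (e : R) : {within `[a, b], continuous f} ->
  {within `[a, b], continuous g} ->
  {in `[a, b], forall x, `|f x - g x| <= e} ->
  `|integral_dF a b F f - integral_dF a b F g| <= e.
Proof.
move=> cf cg fge; have ce : {within `[a, b], continuous (fun=> e : R)}.
  by move=> x; exact: cvg_cst.
have cfe : {within `[a, b], continuous (fun x => f x + e)}.
  by move=> x; apply: cvgD; [exact: cf|exact: cvg_cst].
have cge : {within `[a, b], continuous (fun x => g x + e)}.
  by move=> x; apply: cvgD; [exact: cg|exact: cvg_cst].
have fgE x : x \in `[a, b] -> f x <= g x + e /\ g x <= f x + e.
  by move=> /fge; rewrite ler_norml => /andP[]; lra.
have := le_integral_dF cf cge (fun x xab => (fgE x xab).1).
have := le_integral_dF cg cfe (fun x xab => (fgE x xab).2).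
rewrite !integral_dFD// integral_dF_cst ler_norml => h1 h2.
by apply/andP; split; lra.
Qed.

Lemma LPM_integral_dF n (t : R) :
  LPM n t F = integral_dF a b F (fun x => Num.max (t - x) 0 ^+ n).
Proof.
rewrite /LPM /integral_dF /Rintegral.
pose f := fun x : measurableTypeR R => (Num.max (t - x) 0 ^+ n)%:E.
have mf : measurable_fun setT f.
  apply/measurable_EFinP; apply: continuous_measurable_fun.
  exact: continuous_ramp.
have f0 x : [set: measurableTypeR R] x -> (0 <= f x)%E.
  by move=> _; rewrite lee_fin exprn_ge0// maxr0_ge0.
have := ge0_negligible_integral (measurableC mab) measurableT mf f0 hF.
rewrite setTD setCK => E.
have {}E : fine (\int[mu]_x f x) = fine (\int[mu]_(x in `[a, b]) f x).
  by rewrite E.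
exact: E.
Qed.

End integral_dF_theory.

Section lower_partial_moments.
Context (R : realType) (a b : R) (F : cumulativeBounded (0 : R) (1 : R)).
Context (hF : supported_on a b F).

Let I := integral_dF a b F.

Let cont (f : R -> R) : continuous f -> {within `[a, b], continuous f}.
Proof. exact: continuous_subspaceT. Qed.

Lemma integral_dF_ramp_comb n (L : seq (R * R)) :
  I (ramp_comb n L) = \sum_(p <- L) p.2 / n`!%:R * LPM n p.1 F.
Proof.
elim: L => [|p L IH].
  rewrite big_nil (_ : ramp_comb n [::] = fun=> 0) ?[I _]integral_dF_cst//.
  by apply/funext => x; rewrite /ramp_comb big_nil.
rewrite big_cons -IH (LPM_integral_dF hF) /I -integral_dFZ; last first.
  exact/cont/continuous_ramp.
rewrite -integral_dFD//; last 2 first.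
- move=> x; apply: cvgM; first exact: cvg_cst.
  exact: (cont (@continuous_ramp R n p.1)).
- exact/cont/continuous_ramp_comb.
by apply: eq_Rintegral => x _; rewrite ramp_comb_cons; congr (_ + _); ring.
Qed.

(** On [a, b] no maximum is active once t >= b, and (t - x)^2 is expanded around b. The last term,
    the integral of a constant, is the same for F and G. *)
Lemma LPM2_shift (t : R) : b <= t ->
  LPM 2 t F = LPM 2 b F + 2 * (t - b) * LPM 1 b F + (t - b) ^+ 2.
Proof.
move=> bt; rewrite !(LPM_integral_dF hF).
have c1 := cont (@continuous_ramp R 1 b).
have c2 := cont (@continuous_ramp R 2 b).
have c3 : {within `[a, b], continuous
    (fun x => 2 * (t - b) * Num.max (b - x) 0 ^+ 1)}.
  by move=> x; apply: cvgM; [exact: cvg_cst|exact: c1].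
have c4 : {within `[a, b], continuous (fun x => Num.max (b - x) 0 ^+ 2 +
    2 * (t - b) * Num.max (b - x) 0 ^+ 1)}.
  by move=> x; apply: cvgD; [exact: c2|exact: c3].
rewrite -(integral_dFZ _ _ c1) -(integral_dFD _ c2 c3).
rewrite -[X in _ + X](integral_dF_cst hF) -integral_dFD//; last first.
  by move=> x; exact: cvg_cst.
apply: eq_Rintegral => x; rewrite inE/= in_itv/= => /andP[_ xb].
rewrite !max_l ?subr_ge0// ?(le_trans xb)//; ring.
Qed.

Lemma LPM3_shift (t : R) : b <= t ->
  LPM 3 t F = LPM 3 b F + 3 * (t - b) * LPM 2 b F
    + 3 * (t - b) ^+ 2 * LPM 1 b F + (t - b) ^+ 3.
Proof.
move=> bt; rewrite !(LPM_integral_dF hF).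
have c1 := cont (@continuous_ramp R 1 b).
have c2 := cont (@continuous_ramp R 2 b).
have c3 := cont (@continuous_ramp R 3 b).
have c1' : {within `[a, b], continuous
    (fun x => 3 * (t - b) ^+ 2 * Num.max (b - x) 0 ^+ 1)}.
  by move=> x; apply: cvgM; [exact: cvg_cst|exact: c1].
have c2' : {within `[a, b], continuous
    (fun x => 3 * (t - b) * Num.max (b - x) 0 ^+ 2)}.
  by move=> x; apply: cvgM; [exact: cvg_cst|exact: c2].
have c32 : {within `[a, b], continuous (fun x => Num.max (b - x) 0 ^+ 3 +
    3 * (t - b) * Num.max (b - x) 0 ^+ 2)}.
  by move=> x; apply: cvgD; [exact: c3|exact: c2'].
have c321 : {within `[a, b], continuous (fun x => Num.max (b - x) 0 ^+ 3 +
    3 * (t - b) * Num.max (b - x) 0 ^+ 2 +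
    3 * (t - b) ^+ 2 * Num.max (b - x) 0 ^+ 1)}.
  by move=> x; apply: cvgD; [exact: c32|exact: c1'].
rewrite -(integral_dFZ _ _ c1) -(integral_dFZ _ _ c2) -(integral_dFD _ c3 c2').
rewrite -(integral_dFD _ c32 c1').
rewrite -[X in _ + X](integral_dF_cst hF) -integral_dFD//; last first.
  by move=> x; exact: cvg_cst.
apply: eq_Rintegral => x; rewrite inE/= in_itv/= => /andP[_ xb].
rewrite !max_l ?subr_ge0// ?(le_trans xb)//; ring.
Qed.

End lower_partial_moments.

(** * Dominance over the class and moments on [a, c] *)

Section dominance.
Context (R : realType) (a b c : R) (hab : a < b) (hbc : b < c).
Context (F G : cumulativeBounded (0 : R) (1 : R)).
Context (hF : supported_on a b F) (hG : supported_on a b G).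

Let ac : a < c. Proof. exact: lt_trans hab hbc. Qed.

Let abac x : x \in `[a, b] -> x \in `[a, c].
Proof.
by rewrite !in_itv/= => /andP[-> xb]; rewrite (le_trans xb)// ltW.
Qed.

Lemma Uset_within_continuous n u : Uset n a c u ->
  {within `[a, b], continuous u}.
Proof.
move=> Uu; have [cu _] := Uset_has_deriv Uu (leq0n n).
exact: (continuous_subspaceW abac cu).
Qed.

(** Necessity tests dominance on smooth approximations of -(t - x)_+^n / n!. Sufficiency
    approximates u by u(c) minus a nonnegative combination of ramps; the constant has the same
    integral for F and G. *)
Lemma vanishing_Uset_dominance n : (0 < n)%N ->
  (forall u, vanishing_Uset n a c u ->
    integral_dF a b F u <= integral_dF a b G u) <->
  (forall t, t \in `[a, c] -> LPM n t G <= LPM n t F).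
Proof.
case: n => [|n] n0; first by rewrite ltnn in n0.
split=> [dom t tac|dom u Ku].
- rewrite (LPM_integral_dF hF) (LPM_integral_dF hG).
  have f0 : 0 < n.+1`!%:R :> R by rewrite ltr0n fact_gt0.
  set r := fun x : R => Num.max (t - x) 0 ^+ n.+1.
  have cr : {within `[a, b], continuous r}.
    exact/continuous_subspaceT/continuous_ramp.
  (* In general g is not smooth enough to be in the class, so it is reached through approximants, at
     a cost of e / 2 per integral. *)
  pose g := fun x => - (n.+1`!%:R)^-1 * r x.
  have cg : {within `[a, b], continuous g}.
    by move=> x; apply: cvgM; [exact: cvg_cst|exact: cr].
  suff : integral_dF a b F g <= integral_dF a b G g.
    rewrite (integral_dFZ F _ cr) (integral_dFZ G _ cr).
    move: (integral_dF a b F r) (integral_dF a b G r) => p q.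
    by rewrite !mulNr lerN2 ler_pM2l ?invr_gt0.
  apply/ler_addgt0Pr => e e0.
  have e20 : 0 < e / 2 by rewrite divr_gt0.
  have [u Ku ur] := ramp_approx ac n tac e20.
  have cu := Uset_within_continuous Ku.1.
  have ug : {in `[a, b], forall x, `|u x - g x| <= e / 2}.
    move=> x /abac/ur; rewrite /g mulNr opprK mulrC; exact.
  have := integral_dF_close hF cu cg ug.
  have := integral_dF_close hG cu cg ug.
  have := dom u Ku; have := splitr e.
  move: (integral_dF a b F u) (integral_dF a b G u) (e / 2) => Fu Gu e2.
  move: (integral_dF a b F g) (integral_dF a b G g) => Fg Gg h1 h2.
  by rewrite !ler_norml => /andP[h3 h4] /andP[h5 h6]; lra.
- have cu := Uset_within_continuous Ku.1.
  apply/ler_addgt0Pr => e e0.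
  have e20 : 0 < e / 2 by rewrite divr_gt0.
  have [L [L0 LQ]] := ramp_comb_approx ac (Uset_alternating ac Ku.1)
    (alternating_derivs_vanish Ku) e20.
  have cL : {within `[a, b], continuous (ramp_comb n.+1 L)}.
    exact/continuous_subspaceT/continuous_ramp_comb.
  pose g x := u c + (-1) * ramp_comb n.+1 L x.
  have cNL : {within `[a, b], continuous (fun x => (-1) * ramp_comb n.+1 L x)}.
    by move=> x; apply: cvgM; [exact: cvg_cst|exact: cL].
  have cc : {within `[a, b], continuous (fun=> u c)}.
    by move=> x; exact: cvg_cst.
  have cg : {within `[a, b], continuous g}.
    by move=> x; apply: cvgD; [exact: cvg_cst|exact: cNL].
  have ug : {in `[a, b], forall x, `|u x - g x| <= e / 2}.
    move=> x /abac/LQ; rewrite /g -normrN /=; apply: le_trans.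
    by rewrite le_eqVlt; apply/orP; left; apply/eqP; congr `|_|; ring.
  have Eg (H : cumulativeBounded (0 : R) (1 : R)) : supported_on a b H ->
      integral_dF a b H g =
      u c - \sum_(p <- L) p.2 / n.+1`!%:R * LPM n.+1 p.1 H.
    move=> hH; rewrite integral_dFD// integral_dF_cst// integral_dFZ//.
    by rewrite integral_dF_ramp_comb// mulN1r.
  have FG : integral_dF a b F g <= integral_dF a b G g.
    have sum_le (lF lG : R -> R) : (forall t, t \in `[a, c] -> lG t <= lF t) ->
        \sum_(p <- L) p.2 / n.+1`!%:R * lG p.1 <=
        \sum_(p <- L) p.2 / n.+1`!%:R * lF p.1.
      move=> lGF; rewrite big_seq [leRHS]big_seq.
      apply: ler_sum => p /L0[pac p0].
      by rewrite ler_wpM2l ?lGF// divr_ge0.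
    rewrite (Eg F hF) (Eg G hG); apply: lerB (lexx _) _.
    exact: (sum_le (fun t => LPM n.+1 t F) (fun t => LPM n.+1 t G) dom).
  move: FG; have := integral_dF_close hF cu cg ug.
  have := integral_dF_close hG cu cg ug; have := splitr e.
  move: (integral_dF a b F u) (integral_dF a b G u) (e / 2) => Fu Gu e2.
  move: (integral_dF a b F g) (integral_dF a b G g) => Fg Gg h1.
  by rewrite !ler_norml => /andP[h3 h4] /andP[h5 h6] h2; lra.
Qed.

End dominance.

(** * Identification of the intersections *)

Lemma vanishing_Uset_LPset (R : realType) (n : nat) (a c : R) : a < c ->
  (0 < n)%N -> Uset n a c `&` LPset n a c = vanishing_Uset n a c.
Proof.
move=> ac n0; apply/seteqP; split=> u.
  by move=> [Uu Lu]; exact: LPset_vanishing.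
by move=> Ku; split; [exact: Ku.1|exact: vanishing_LPset].
Qed.

Lemma vanishing_Uset_APset (R : realType) (n : nat) (a c : R) : a < c ->
  (1 < n <= 3)%N -> Uset n a c `&` APset n a c = vanishing_Uset n a c.
Proof.
move=> ac n13; apply/seteqP; split=> u.
  by move=> [Uu Au]; exact: APset_vanishing.
by move=> Ku; split; [exact: Ku.1|apply: vanishing_APset; case/andP: n13].
Qed.

(** * Polynomial conditions on [b, c] *)

Lemma quadratic_ge0 (R : realFieldType) (h d1 d2 d3 : R) : 0 < h ->
  (forall s, 0 <= s <= h -> 0 <= d3 + 3 * s * d2 + 3 * s ^+ 2 * d1) <->
  [/\ 0 <= d3, 0 <= d3 + 3 * h * d2 + 3 * h ^+ 2 * d1 &
   0 < d1 -> - 2 * h * d1 < d2 < 0 -> 3 * d2 ^+ 2 <= 4 * d1 * d3].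
Proof.
move=> h0; split=> [q0|[q00 qh disc] s /andP[s0 sh]].
  split; [|by apply: q0; rewrite lexx ltW|].
    by have := q0 0; rewrite lexx (ltW h0) => /(_ isT); rewrite expr0n/=; lra.
  move=> d10 /andP[d2l d2u].
  have d1n : d1 != 0 by rewrite lt0r_neq0.
  (* This is the vertex of the parabola; the bounds on d2 place it inside ]0, h[. *)
  have := q0 (- d2 / (2 * d1)).
  rewrite divr_ge0 ?oppr_ge0 ?(ltW d2u) ?mulr_ge0 ?(ltW d10)//=.
  rewrite ler_pdivrMr ?mulr_gt0// => /(_ _)/le_trans.
  have -> : (- d2 <= h * (2 * d1)) by lra.
  move=> /(_ _ isT) => q.
  have : 0 <= 4 * d1 * (d3 + 3 * (- d2 / (2 * d1)) * d2 +
      3 * (- d2 / (2 * d1)) ^+ 2 * d1).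
    by rewrite mulr_ge0 ?mulr_ge0 ?(ltW d10)//; apply: q.
  rewrite (_ : _ * (_ + _) = 4 * d1 * d3 - 3 * d2 ^+ 2) ?subr_ge0//.
  by field.
have hs : 0 <= h - s by rewrite subr_ge0.
have [d10|d10] := leP d1 0.
  (* Concave case: the quadratic lies above its chord over [0, h]. *)
  rewrite -(pmulr_rge0 _ h0).
  have -> : h * (d3 + 3 * s * d2 + 3 * s ^+ 2 * d1) =
      (h - s) * d3 + s * (d3 + 3 * h * d2 + 3 * h ^+ 2 * d1)
      + 3 * (- d1) * (s * (h - s) * h) by ring.
  by rewrite !addr_ge0 ?mulr_ge0 ?oppr_ge0// ltW.
have [d20|d20] := leP 0 d2.
  by rewrite !addr_ge0 ?mulr_ge0 ?(ltW d10)// exprn_ge0.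
have [d2l|d2l] := leP d2 (- 2 * h * d1).
  (* The vertex is at h or beyond, so the quadratic decreases on [0, h] and is compared with its
     value at h. *)
  rewrite (_ : _ + _ = (d3 + 3 * h * d2 + 3 * h ^+ 2 * d1) +
    3 * (h - s) * (- (d2 + d1 * (s + h)))); last by ring.
  rewrite addr_ge0// mulr_ge0 ?mulr_ge0// oppr_ge0.
  have : d1 * (s + h) <= d1 * (h + h) by rewrite ler_pM2l// lerD2r.
  lra.
have d140 : 0 < 4 * d1 by rewrite mulr_gt0.
(* The vertex is inside: multiply by 4 d1 and complete the square. *)
rewrite -(pmulr_rge0 _ d140).
have := disc d10; rewrite d2l d20 => /(_ isT) hd.
have := sqr_ge0 (d2 + 2 * d1 * s).
have -> : 4 * d1 * (d3 + 3 * s * d2 + 3 * s ^+ 2 * d1) =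
  (4 * d1 * d3 - 3 * d2 ^+ 2) + 3 * (d2 + 2 * d1 * s) ^+ 2 by ring.
lra.
Qed.

Section tail_conditions.
Context (R : realType) (a b c : R) (hab : a < b) (hbc : b < c).

Let bab : b \in `[a, b]. Proof. by rewrite in_itv/= lexx ltW. Qed.

Let itvac t : t \in `[a, c] <-> t \in `[a, b] \/ b <= t <= c.
Proof.
rewrite !in_itv/=; split=> [/andP[at_ tc]|[/andP[at_ tb]|/andP[bt tc]]].
- by case: (leP t b) => tb; [left; rewrite at_|right; rewrite (ltW tb)].
- by rewrite at_ (le_trans tb)// ltW.
- by rewrite tc (le_trans _ bt)// ltW.
Qed.

Let sub t : (`[a, b] `|` [set c]) t -> t \in `[a, c].
Proof.
move=> [tab|->]; apply/itvac; first by left.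
by right; rewrite lexx ltW.
Qed.

(** The squares cancel, so the difference is affine on [b, c]: its value at t is a weighted mean of
    those at b and c. *)
Lemma le_affine_tail (lF lG : R -> R) (F1 G1 : R) :
  (forall t, b <= t -> lF t = lF b + 2 * (t - b) * F1 + (t - b) ^+ 2) ->
  (forall t, b <= t -> lG t = lG b + 2 * (t - b) * G1 + (t - b) ^+ 2) ->
  (forall t, t \in `[a, c] -> lG t <= lF t) <->
  (forall t, (`[a, b] `|` [set c]) t -> lG t <= lF t).
Proof.
move=> hF hG; split=> [dom t /sub/dom//|dom t].
move=> /itvac[tab|/andP[bt tc]]; first by apply: dom; left.
have := dom b (or_introl bab); have := dom c (or_intror erefl).
rewrite (hF c (ltW hbc)) (hG c (ltW hbc)) (hF t bt) (hG t bt).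
move: (lF b) (lG b) => F2 G2 hc hb.
have h0 : 0 < c - b by rewrite subr_gt0.
rewrite -subr_ge0 -(pmulr_rge0 _ h0).
have t1 : 0 <= t - b by rewrite subr_ge0.
have t2 : 0 <= c - t by rewrite subr_ge0.
have := ler_wpM2l t2 hb; have := ler_wpM2l t1 hc => h1 h2.
lra.
Qed.

(** The cubes cancel, and [quadratic_ge0] applies to the difference in the variable s = t - b, with
    h = c - b. *)
Lemma le_quadratic_tail (lF lG : R -> R) (F1 F2 G1 G2 : R) :
  (forall t, b <= t -> lF t =
    lF b + 3 * (t - b) * F2 + 3 * (t - b) ^+ 2 * F1 + (t - b) ^+ 3) ->
  (forall t, b <= t -> lG t =
    lG b + 3 * (t - b) * G2 + 3 * (t - b) ^+ 2 * G1 + (t - b) ^+ 3) ->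
  (forall t, t \in `[a, c] -> lG t <= lF t) <->
  (forall t, (`[a, b] `|` [set c]) t -> lG t <= lF t) /\
  (0 < F1 - G1 -> - 2 * (c - b) * (F1 - G1) < F2 - G2 < 0 ->
   3 * (F2 - G2) ^+ 2 <= 4 * (F1 - G1) * (lF b - lG b)).
Proof.
move=> hF hG; have h0 : 0 < c - b by rewrite subr_gt0.
have quad := quadratic_ge0 (F1 - G1) (F2 - G2) (lF b - lG b) h0.
have shift t : b <= t -> lF t - lG t = (lF b - lG b)
    + 3 * (t - b) * (F2 - G2) + 3 * (t - b) ^+ 2 * (F1 - G1).
  by move=> bt; rewrite (hF t bt) (hG t bt); ring.
split=> [dom|[dom disc] t].
  split; first by move=> t /sub/dom.
  have [|_ _ //] := quad.1 _.
  move=> s /andP[s0 sh]; have bs : b <= b + s by rewrite lerDl.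
  have := shift _ bs; rewrite (addrC b) addrK => <-.
  by rewrite subr_ge0 dom//; apply/itvac; right; apply/andP; split; lra.
move=> /itvac[tab|/andP[bt tc]]; first by apply: dom; left.
rewrite -subr_ge0 shift//; apply: quad.2; last by rewrite subr_ge0 bt lerD2r.
split=> //; first by rewrite subr_ge0 dom//; left.
by rewrite -shift ?(ltW hbc)// subr_ge0 dom//; right.
Qed.

End tail_conditions.

Theorem theorem2 (R : realType) (a b c : R) (hab : a < b) (hbc : b < c)
    (F G : cumulativeBounded (0 : R) (1 : R))
    (hF : supported_on a b F) (hG : supported_on a b G) :
  (* (i) *)
  (Uset 2 a c `&` LPset 2 a c = Uset 2 a c `&` APset 2 a c /\
   ((forall u, (Uset 2 a c `&` LPset 2 a c) u ->
       integral_dF a b F u <= integral_dF a b G u) <->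
    (forall t, (`[a, b] `|` [set c]) t -> LPM 2 t G <= LPM 2 t F)))
  /\
  (* (ii) *)
  (Uset 3 a c `&` LPset 3 a c = Uset 3 a c `&` APset 3 a c /\
   ((forall u, (Uset 3 a c `&` LPset 3 a c) u ->
       integral_dF a b F u <= integral_dF a b G u) <->
    (forall t, (`[a, b] `|` [set c]) t -> LPM 3 t G <= LPM 3 t F) /\
    (0 < LPM 1 b F - LPM 1 b G ->
     - 2 * (c - b) * (LPM 1 b F - LPM 1 b G) < LPM 2 b F - LPM 2 b G < 0 ->
     3 * (LPM 2 b F - LPM 2 b G) ^+ 2
       <= 4 * (LPM 1 b F - LPM 1 b G) * (LPM 3 b F - LPM 3 b G)))).
Proof.
have ac : a < c := lt_trans hab hbc.
have LPK n := @vanishing_Uset_LPset R n a c ac.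
have APK n := @vanishing_Uset_APset R n a c ac.
have dominance n := @vanishing_Uset_dominance R a b c hab hbc F G hF hG n.
split; split.
- by rewrite (LPK 2 isT) (APK 2 isT).
- rewrite (LPK 2 isT); apply: (iff_trans (dominance 2 isT)).
  exact: (@le_affine_tail R a b c hab hbc (fun t => LPM 2 t F)
    (fun t => LPM 2 t G) _ _ (LPM2_shift hF) (LPM2_shift hG)).
- by rewrite (LPK 3 isT) (APK 3 isT).
- rewrite (LPK 3 isT); apply: (iff_trans (dominance 3 isT)).
  exact: (@le_quadratic_tail R a b c hab hbc (fun t => LPM 3 t F)
    (fun t => LPM 3 t G) _ _ _ _ (LPM3_shift hF) (LPM3_shift hG)).
Qed.
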